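(* Let $\mathfrak g$ be an affine Lie algebra of type $X^{(r)}_N$ (any type in the list in the context), let $1\le b\le n$, let $l\in\mathbb Z_{\ge1}$ with $l/t_b\in\mathbb Z$, and let $\lambda\in\overline P$. Then $$\lim q^{-c_0}M_\infty\bigl((W^{(b)}_l)^{\otimes L},\lambda,q\bigr)=\sum_\zeta\frac{M_\infty(W(\zeta),\lambda,q^{-1})\,M_{l/t_b}(W(\zeta),0,q^{-1})}{(q_1)_{\zeta_1}\cdots(q_n)_{\zeta_n}},\qquad W(\zeta)=\bigotimes_{a=1}^n(W^{(a)}_1)^{\otimes\zeta_a}.$$ Here $\lim$ is the limit $L\to\infty$ taken over positive integers $L$ such that $L(\iota(\overline{\Lambda}_a)|\iota(\overline{\Lambda}_b))/(t^\vee_at_b)\in\mathbb Z$ for all $1\le a\le n$; $c_0=-L^2l\,|\iota(\overline{\Lambda}_b)|^2/(2t_b)\in\mathbb Z$; and the sum runs over $\zeta_1,\dots,\zeta_n\in\mathbb Z_{\ge0}$ such that $\sum_{a=1}^n\zeta_a\iota(\overline{\Lambda}_a)\in\bigoplus_{a=1}^n\mathbb Z_{\ge0}\tilde\alpha_a$. Convergence is in the $q$-adic topology.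
   Context: **Affine data.** $\mathfrak g=X^{(r)}_N$ is one of $A^{(1)}_n\,(n\ge1)$, $B^{(1)}_n\,(n\ge3)$, $C^{(1)}_n\,(n\ge2)$, $D^{(1)}_n\,(n\ge4)$, $E^{(1)}_{6,7,8}$, $F^{(1)}_4$, $G^{(1)}_2$, $A^{(2)}_{2n}\,(n\ge1)$, $A^{(2)}_{2n-1}\,(n\ge2)$, $D^{(2)}_{n+1}\,(n\ge2)$, $E^{(2)}_6$, $D^{(3)}_4$; $n$ is its rank (nodes $0,\dots,n$). $\overset{\circ}{\mathfrak g}$ is obtained by deleting node $0$: it is $X_N$ for $r=1$, and $C_n,C_n,B_n,F_4,G_2$ for $A^{(2)}_{2n},A^{(2)}_{2n-1},D^{(2)}_{n+1},E^{(2)}_6,D^{(3)}_4$. $\mathfrak g_{\overline0}$ equals $\overset{\circ}{\mathfrak g}$ except that $\mathfrak g_{\overline0}=B_n$ for $A^{(2)}_{2n}$ ($B_1=A_1$ when $n=1$). Numbering of nodes $1,\dots,n$: $A_n$: chain; $B_n$: chain, $\alpha_n$ short; $C_n$: chain, $\alpha_n$ long; $D_n$: chain $1,\dots,n-2$ with $n-2$ joined to $n-1$ and $n$; $E_6$: chain $1,\dots,5$, node $6$ joined to $3$; $E_7$: chain $1,\dots,6$, node $7$ joined to $3$; $E_8$: chain $1,\dots,7$, node $8$ joined to $5$; $F_4$: chain $1,2,3,4$ with $\alpha_1,\alpha_2$ long for $F^{(1)}_4$ and $\alpha_1,\alpha_2$ short for $E^{(2)}_6$; $G_2$: $\alpha_1$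 long, $\alpha_2$ short for $G^{(1)}_2$, and $\alpha_1$ short, $\alpha_2$ long for $D^{(3)}_4$. Integers $t_a$ ($1\le a\le n$): $t_n=2$ for $B^{(1)}_n$; $t_a=2$ for $a<n$ for $C^{(1)}_n$; $t_3=t_4=2$ for $F^{(1)}_4$; $t_2=3$ for $G^{(1)}_2$; all other $t_a=1$. Integers $t^\vee_a$: $t^\vee_a=2$ for all $a$ for $A^{(2)}_{2n}$; $t^\vee_n=2$ for $A^{(2)}_{2n-1}$; $t^\vee_a=2$ for $a<n$ for $D^{(2)}_{n+1}$; $t^\vee_3=t^\vee_4=2$ for $E^{(2)}_6$; $t^\vee_2=3$ for $D^{(3)}_4$; all other $t^\vee_a=1$. $\epsilon_a=2$ if $\mathfrak g=A^{(2)}_{2n}$ and $a=n$; $\epsilon_a=1$ otherwise. Put $q_a=q^{t^\vee_a}$ and $(x)_k=\prod_{i=1}^k(1-x^i)$. $\overline{\Lambda}_a$ are the fundamental weights of $\overset{\circ}{\mathfrak g}$ and $\overline P=\bigoplus\mathbb Z\overline{\Lambda}_a$. $\tilde\alpha_a,\tilde\Lambda_a$ are the simple roots and fundamental weights of $\mathfrak g_{\overline0}$ (same numbering), with invariant form $(\cdot|\cdot)$ normalized so that long roots have square length $2r$ (for $A^{(2)}_2$: $(\tilde\alpha_1|\tilde\alpha_1)=2$); equivalently $\frac{\epsilon_at_a}{t^\vee_a}(\tilde\alpha_a|\tilde\alpha_b)$ is the Cartan matrix $2(\tilde\alpha_a|\tilde\alpha_b)/(\tilde\alpha_a|\tilde\alpha_a)$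 of $\mathfrak g_{\overline0}$. $|\mu|^2=(\mu|\mu)$. $\iota$ is the linear map with $\iota(\overline{\Lambda}_a)=\epsilon_a\tilde\Lambda_a$. **Fermionic form $M_l$.** Let $l\in\mathbb Z_{\ge1}\cup\{\infty\}$, $H_l=\{(a,i)\mid1\le a\le n,\ 1\le i\le t_al\}$ (for $l=\infty$, all $i\ge1$). Let $\nu^{(a)}_j\in\mathbb Z_{\ge0}$ for $(a,j)\in H_l$, with finitely many non-zero, recorded by the formal symbol $W=\bigotimes_{(a,j)\in H_l}(W^{(a)}_j)^{\otimes\nu^{(a)}_j}$, and let $\lambda\in\overline P$. Define $$M_l(W,\lambda,q)=\sum_{\{m\}}q^{c(\{m\})}\prod_{(a,i)\in H_l}\left[\begin{array}{c}p^{(a)}_i+m^{(a)}_i\\ m^{(a)}_i\end{array}\right]_{q_a},$$ $$c(\{m\})=\tfrac12\sum_{(a,j),(b,k)\in H_l}(\tilde\alpha_a|\tilde\alpha_b)\min(t_bj,t_ak)m^{(a)}_jm^{(b)}_k-\sum_{a=1}^nt^\vee_a\sum_{1\le j,k\le t_al}\min(j,k)\nu^{(a)}_jm^{(a)}_k,$$ $$p^{(a)}_i=\sum_{j=1}^{t_al}\nu^{(a)}_j\min(i,j)-\frac1{t^\vee_a}\sum_{(b,k)\in H_l}(\tilde\alpha_a|\tilde\alpha_b)\min(t_bi,t_ak)m^{(b)}_k,$$ where the sum is over $m^{(a)}_i\in\mathbb Z_{\ge0}$, $(a,i)\in H_l$, such that $p^{(a)}_j\ge0$ for all $(a,j)\in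 H_l$ and $\sum_{(a,i)\in H_l}i\,m^{(a)}_i\tilde\alpha_a=\iota\bigl(\sum_{(a,i)\in H_l}i\nu^{(a)}_i\overline{\Lambda}_a-\lambda\bigr)$. Here $\left[\begin{array}{c}p+m\\ m\end{array}\right]_q=\prod_{i=1}^m\frac{1-q^{p+i}}{1-q^i}$. $M_l(W,\lambda,q^{-1})$ denotes the result of substituting $q\mapsto q^{-1}$.
   Formalization: The printed c_0 = -L^2 l |ι(Λ_b)|^2/(2t_b) is replaced by c_0 = -L^2 l t_b |ι(Λ_b)|^2/2; they agree when t_b = 1, and for t_b > 1 the printed one fails (C_2^{(1)}, b=1, l=2, λ=0: the exponent -L^2 lies below -L^2/4). *)

(* Defs.v *)
From HB Require Import structures.
From mathcomp Require Import all_boot all_order all_algebra.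
From mathcomp Require Import finmap ring.
From mathcomp Require Import boolp classical_sets cardinality fsbigop.

Set Implicit Arguments.
Unset Strict Implicit.
Unset Printing Implicit Defensive.

Import Order.TTheory GRing.Theory Num.Theory.
Local Open Scope classical_set_scope.
Local Open Scope ring_scope.

Inductive affine_type : Type :=
| affA1 of nat | affB1 of nat | affC1 of nat | affD1 of nat
| affE61 | affE71 | affE81 | affF41 | affG21
| affA2even of nat (* affA2even n is A^(2)_{2n} *)
| affA2odd of nat  (* affA2odd n is A^(2)_{2n-1} *)
| affD2 of nat     (* affD2 n is D^(2)_{n+1} *)
| affE62 | affD43.

Definition valid_type (X : affine_type) : bool :=
  match X with
  | affA1 n => 1 <= n | affB1 n => 3 <= n
  | affC1 n => 2 <= n | affD1 n => 4 <= n
  | affA2even n => 1 <= n | affA2odd n => 2 <= n | affD2 n => 2 <= n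
  | _ => true
  end%N.

Definition rank (X : affine_type) : nat :=
  match X with
  | affA1 n | affB1 n | affC1 n | affD1 n => n
  | affA2even n | affA2odd n | affD2 n => n
  | affE61 => 6 | affE71 => 7 | affE81 => 8
  | affF41 => 4 | affG21 => 2 | affE62 => 4 | affD43 => 2
  end.

(* The superscript r of X^(r)_N. *)
Definition twist (X : affine_type) : nat :=
  match X with
  | affA2even _ | affA2odd _ | affD2 _ | affE62 => 2
  | affD43 => 3
  | _ => 1
  end.

(* The classical nodes 1, ..., n are the ordinals 0, ..., n-1. *)
Definition node (X : affine_type) := 'I_(rank X).
Definition label (X : affine_type) (a : node X) : nat := a.+1.

Definition t (X : affine_type) (a : node X) : nat :=
  match X with
  | affB1 n => if label a == n then 2 else 1
  | affC1 n => if label a < n then 2 else 1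
  | affF41 => if label a \in [:: 3; 4] then 2 else 1
  | affG21 => if label a == 2 then 3 else 1
  | _ => 1
  end%N.

Definition tv (X : affine_type) (a : node X) : nat :=
  match X with
  | affA2even _ => 2
  | affA2odd n => if label a == n then 2 else 1
  | affD2 n => if label a < n then 2 else 1
  | affE62 => if label a \in [:: 3; 4] then 2 else 1
  | affD43 => if label a == 2 then 3 else 1
  | _ => 1
  end%N.

Definition eps (X : affine_type) (a : node X) : nat :=
  match X with
  | affA2even n => if label a == n then 2 else 1
  | _ => 1
  end%N.

(* Dynkin diagram of g_0bar: nodes 1, ..., n-1 form a chain, and node n is
   joined to node [attach X] (which is n-1 when the whole diagram is a chain). *)
Definition attach (X : affine_type) : nat :=
  match X with
  | affD1 n => n - 2
  | affE61 => 3 | affE71 => 3 | affE81 => 5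
  | X => (rank X).-1
  end%N.

Definition edge (X : affine_type) (i j : nat) : bool :=
  (i.+1 == j) && (j < rank X)%N || (i == attach X) && (j == rank X).

Definition adjacent (X : affine_type) (a b : node X) : bool :=
  edge X (label a) (label b) || edge X (label b) (label a).

(* The short simple roots of g_0bar; for A^(2)_2, where g_0bar = B_1, the single
   root counts as short, which gives it square length 2 below. *)
Definition short (X : affine_type) (a : node X) : bool :=
  match X with
  | affB1 n | affD2 n | affA2even n => label a == n
  | affC1 n | affA2odd n => (label a < n)%N
  | affF41 => label a \in [:: 3; 4]%N
  | affE62 => label a \in [:: 1; 2]%N
  | affG21 => label a == 2
  | affD43 => label a == 1
  | _ => false
  end.

(* Ratio of the square lengths of the long and the short roots. *)
Definition lacing (X : affine_type) : nat :=
  match X with affG21 | affD43 => 3 | _ => 2 end.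

(* (alpha_a|alpha_a), long roots having square length 2r. *)
Definition sqlen (X : affine_type) (a : node X) : rat :=
  if short a then (2 * twist X)%:R / (lacing X)%:R else (2 * twist X)%:R.

(* Two joined simple roots satisfy 2(alpha_a|alpha_b)/(alpha_a|alpha_a) = -1,
   alpha_a being the longer one. *)
Definition gram (X : affine_type) : 'M[rat]_(rank X) :=
  \matrix_(a, b)
    if a == b then sqlen a
    else if adjacent a b then - (Num.max (sqlen a) (sqlen b) / 2) else 0.

(* The rational span of the roots of g_0bar, in the basis of simple roots. *)
Definition qspan (X : affine_type) := 'rV[rat]_(rank X).

Definition invform (X : affine_type) (u v : qspan X) : rat :=
  (u *m gram X *m v^T) 0 0.

Definition alpha (X : affine_type) (a : node X) : qspan X := delta_mx 0 a.

(* Determined by (Lambda_a|alpha_b) = delta_{ab} (alpha_a|alpha_a) / 2. *)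
Definition fundw (X : affine_type) (a : node X) : qspan X :=
  (sqlen a / 2) *: row a (invmx (gram X)).

(* The lattice Pbar, in the basis of fundamental weights Lambdabar_a. *)
Definition weight (X : affine_type) := 'rV[int]_(rank X).

Definition fundwbar (X : affine_type) (a : node X) : weight X := delta_mx 0 a.

Definition wiota (X : affine_type) (mu : weight X) : qspan X :=
  \sum_a ((mu 0 a)%:~R * (eps a)%:R) *: fundw a.

(* Levels range over {1, 2, ...} and infinity; None stands for infinity. *)
Definition level := option nat.

Definition Hset (X : affine_type) (l : level) : set (node X * nat) :=
  [set x | (1 <= x.2)%N /\
           if l is Some k then (x.2 <= t x.1 * k)%N else True].

Arguments Hset X l : clear implicits.

(* Finitely supported families (nu^(a)_j) or (m^(a)_j), as functions of (a, j). *)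
Definition config (X : affine_type) := {fsfun node X * nat -> nat with 0%N}.

Section FermionicForm.
Context (X : affine_type) (l : level) (nu : config X).
Implicit Types (m : config X) (lam : weight X).

Local Notation H := (Hset X l).
Local Notation Hrow a := [set j : nat | H (a, j)].

Definition cocharge m : rat :=
  2^-1 * (\sum_(x \in H) \sum_(y \in H)
            invform (alpha x.1) (alpha y.1) *
            (minn (t y.1 * x.2) (t x.1 * y.2) * m x * m y)%:R)
  - \sum_a (tv a)%:R *
      \sum_(j \in Hrow a) \sum_(k \in Hrow a)
        ((minn j k * nu (a, j) * m (a, k))%:R : rat).

Definition vacancy m (x : node X * nat) : rat :=
  \sum_(j \in Hrow x.1) ((nu (x.1, j) * minn x.2 j)%:R : rat)
  - (tv x.1)%:R^-1 *
      \sum_(y \in H)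
        invform (alpha x.1) (alpha y.1) *
        (minn (t y.1 * x.2) (t x.1 * y.2) * m y)%:R.

Definition admissible lam : set (config X) :=
  [set m : config X | [/\ forall x, ~ H x -> m x = 0%N,
               forall x, H x -> 0 <= vacancy m x
             & \sum_(x \in H) (x.2 * m x)%:R *: alpha x.1 =
               wiota (\sum_(x \in H) (fundwbar x.1 *+ (x.2 * nu x)) - lam)]].

Definition qbinom (F : fieldType) (x : F) (p m : nat) : F :=
  \prod_(1 <= i < m.+1) ((1 - x ^+ (p + i)) / (1 - x ^+ i)).

(* The fermionic form M_l(W, lam, x), where W is given by nu.  The cocharge and
   the vacancy numbers are integers (cocharge_int, vacancy_int), the latter being
   nonnegative here, so Num.floor and Num.truncn only change their type; the sum
   is finite (admissible_finite). *)
Definition fermionic lam (F : fieldType) (x : F) : F :=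
  \sum_(m \in admissible lam)
    x ^ Num.floor (cocharge m) *
    \big[*%R/1]_(y \in H)
      qbinom (x ^+ tv y.1) (Num.truncn (vacancy m y)) (m y).

End FermionicForm.

(* (W^(b)_j)^{\otimes L} *)
Definition Wpower (X : affine_type) (b : node X) (j L : nat) : config X :=
  [fsfun x in [fset (b, j)]%fset => L].

(* \bigotimes_a (W^(a)_1)^{\otimes zeta_a} *)
Definition Wzeta (X : affine_type) (zeta : {ffun node X -> nat}) : config X :=
  [fsfun x in [fset (a, 1%N) | a in node X]%fset => zeta x.1].

(* (x)_k *)
Definition qpoch (F : fieldType) (x : F) (k : nat) : F :=
  \prod_(1 <= i < k.+1) (1 - x ^+ i).

(* The field Q(q), its q-adic topology, and its completion Q((q)). *)
Definition ratfun := {fraction {poly rat}}.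

Definition q : ratfun := tofrac 'X.

(* x belongs to q^N Q[q]_(q), i.e. x has q-adic valuation at least N. *)
Definition qadic_small (N : int) (x : ratfun) : Prop :=
  exists f g : {poly rat}, g.[0] != 0 /\ x = q ^ N * (tofrac f / tofrac g).

(* The series \sum_{k >= 0} coef_k q^{k - pole} *)
Record laurent := Laurent { pole : nat; coef : nat -> rat }.

Definition truncation (S : laurent) (N : nat) : ratfun :=
  \sum_(k < N) tofrac (coef S k)%:P * q ^ (k%:Z - (pole S)%:Z).

(* The difference of x and S lies in q^{N - pole} Q[[q]]. *)
Definition qadic_near (S : laurent) (N : nat) (x : ratfun) : Prop :=
  qadic_small (N%:Z - (pole S)%:Z) (x - truncation S N).

Definition qadic_limit (A : set nat) (u : nat -> ratfun) (S : laurent) : Prop :=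
  forall N, exists L0, forall L, (L0 <= L)%N -> A L -> qadic_near S N (u L).

Definition qadic_sum (I : choiceType) (A : set I) (u : I -> ratfun)
    (S : laurent) : Prop :=
  forall N, exists2 J0 : {fset I}, [set` J0] `<=` A &
    forall J : {fset I}, (J0 `<=` J)%fset -> [set` J] `<=` A ->
      qadic_near S N (\sum_(i <- J) u i).

Lemma invform_alpha (X : affine_type) (a b : node X) :
  invform (alpha a) (alpha b) = gram X a b.
Proof.
by rewrite /invform /alpha -rowE trmx_delta -colE !mxE.
Qed.

Lemma gram_sym (X : affine_type) (a b : node X) : gram X a b = gram X b a.
Proof.
by rewrite !mxE /adjacent orbC eq_sym maxC; case: eqP => // ->.
Qed.

Lemma sqlenE (X : affine_type) (a : node X) :
  sqlen a = (2 * tv a)%:R / (eps a * t a)%:R.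
Proof.
case: X a => [n|n|n|n||||||n|n|n||] a;
  rewrite /sqlen /tv /eps /t /short /label /lacing /twist /=;
  move: (ltn_ord a) => /=; rewrite ?inE.
all: try by case: ifP.
all: try by move=> _; apply/eqP.
- by rewrite leq_eqVlt => /orP[/eqP ->|]; rewrite ?eqxx ?ltnn // => h; rewrite h (ltn_eqF h).
- by rewrite leq_eqVlt => /orP[/eqP ->|]; rewrite ?eqxx ?ltnn // => h; rewrite h (ltn_eqF h).
- by case: a => [[|[|[|[|?]]]] ?].
- by case: a => [[|[|?]] ?].
Qed.

Lemma t_neq0 (X : affine_type) (a : node X) : ((t a)%:R : rat) != 0.
Proof. by case: X a => [n|n|n|n||||||n|n|n||] a; rewrite /t //=; case: ifP. Qed.

Lemma tv_neq0 (X : affine_type) (a : node X) : ((tv a)%:R : rat) != 0.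
Proof. by case: X a => [n|n|n|n||||||n|n|n||] a; rewrite /tv //=; case: ifP. Qed.

Lemma eps_neq0 (X : affine_type) (a : node X) : ((eps a)%:R : rat) != 0.
Proof. by case: X a => [n|n|n|n||||||n|n|n||] a; rewrite /eps //=; case: ifP. Qed.

Lemma gram_tv_int (X : affine_type) (a b : node X) :
  gram X a b / (tv a)%:R * (gcdn (t a) (t b))%:R \is a Num.int.
Proof.
rewrite mxE; case: eqP => [<-|neq].
  rewrite sqlenE gcdnn natrM.
  have -> : (2 * (tv a)%:R / (eps a * t a)%:R / (tv a)%:R * (t a)%:R : rat) =
            2 / (eps a)%:R.
    have t0 := t_neq0 a. have v0 := tv_neq0 a. have e0 := eps_neq0 a.
    by rewrite natrM; field; rewrite t0 v0 e0.
  case: X a {b} => [n|n|n|n||||||n|n|n||] a; rewrite /eps //=; case: ifP => //.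
case: ifP => [adj|_]; last by rewrite mul0r mul0r.
case: X a b neq adj => [n|n|n|n||||||n|n|n||] a b neq adj;
  rewrite /sqlen /tv /t /short /label /lacing /twist /=; move: adj neq (ltn_ord a) (ltn_ord b);
  rewrite /adjacent /edge /label /attach /= ?inE.
all: try by [].
all: try by case: (_ == n); case: (_ == n).
all: try by case: (_ < n)%N; case: (_ < n)%N.
- by case: a b => [[|[|[|[|?]]]] ?] [[|[|[|[|?]]]] ?].
- by case: a b => [[|[|?]] ?] [[|[|?]] ?].
- move=> _ neq _ _; case: eqP => [ea|]; case: eqP => [eb|] //.
  by case: neq; apply/val_inj/eqP; rewrite -eqSS ea eb.
- move=> _ neq an bn.
  case: (ltngtP a.+1 n) an => // ea _; case: (ltngtP b.+1 n) bn => // eb _.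
- move=> _ neq an bn.
  case: (ltngtP a.+1 n) an => // ea _; case: (ltngtP b.+1 n) bn => // eb _.
- by case: a b => [[|[|[|[|?]]]] ?] [[|[|[|[|?]]]] ?].
- by case: a b => [[|[|?]] ?] [[|[|?]] ?].
Qed.

Lemma vacancy_coef_int (X : affine_type) (a b : node X) (i k : nat) :
  (tv a)%:R^-1 * (invform (alpha a) (alpha b) * (minn (t b * i) (t a * k))%:R)
    \is a Num.int.
Proof.
have /dvdnP[u ->] : (gcdn (t a) (t b) %| minn (t b * i) (t a * k))%N.
  by rewrite /minn; case: ifP => _; rewrite dvdn_mulr // ?dvdn_gcdl ?dvdn_gcdr.
rewrite invform_alpha natrM.
have -> : (tv a)%:R^-1 * (gram X a b * (u%:R * (gcdn (t a) (t b))%:R)) =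
    gram X a b / (tv a)%:R * (gcdn (t a) (t b))%:R * u%:R by ring.
by apply: rpredM; [exact: gram_tv_int | exact: rpred_nat].
Qed.

Lemma vacancy_int (X : affine_type) (l : level) (nu m : config X) x :
  vacancy l nu m x \is a Num.int.
Proof.
rewrite rpredB //; first by apply: rpred_sum => ? _; apply: rpred_nat.
rewrite mulr_sumr rpred_sum // => y _.
rewrite natrM (mulrA (invform _ _)) (mulrA _^-1).
by apply: rpredM; [exact: vacancy_coef_int | exact: rpred_nat].
Qed.

Lemma half_sym_sum_int (I : Type) (s : seq I) (P : pred I) (f : I -> I -> rat) :
  (forall x, f x x / 2 \is a Num.int) -> (forall x y, f x y = f y x) ->
  (forall x y, f x y \is a Num.int) ->
  2^-1 * (\sum_(x <- s | P x) \sum_(y <- s | P y) f x y) \is a Num.int.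
Proof.
move=> f1 f2 f3; elim: s => [|x s ih]; first by rewrite !big_nil mulr0.
rewrite big_cons; case: ifP => Px; last first.
  by under eq_bigr do rewrite big_cons Px.
under [X in _ + X]eq_bigr do rewrite big_cons Px f2.
rewrite big_split /= big_cons Px.
set A := \sum_(j <- s | P j) f x j; set B := \sum_(i <- s | P i) _ in ih *.
have -> : 2^-1 * (f x x + A + (A + B)) = f x x / 2 + A + 2^-1 * B by field.
by rewrite !rpredD // rpred_sum.
Qed.

Lemma fsbig_supp_seq (V : nmodType) (I : choiceType) (H : set I) (s : seq I)
    (F : I -> V) :
  uniq s -> (forall x, x \notin s -> F x = 0) ->
  \sum_(x \in H) F x = \sum_(x <- s | x \in H) F x.
Proof.
move=> us Fs; rewrite [RHS]bigfs ?set_mem_set // => x _; exact: Fs.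
Qed.

Lemma cocharge_int (X : affine_type) (l : level) (nu m : config X) :
  cocharge l nu m \is a Num.int.
Proof.
rewrite rpredB //; last first.
  rewrite rpred_sum // => a _; rewrite rpredM ?rpred_nat // rpred_sum // => j _.
  by rewrite rpred_sum // => k _; rewrite rpred_nat.
pose f (x y : node X * nat) : rat := invform (alpha x.1) (alpha y.1) *
  (minn (t y.1 * x.2) (t x.1 * y.2) * m x * m y)%:R.
have fm0 x y : y \notin finsupp m -> f x y = 0.
  by move=> ym; rewrite /f [m y]fsfun_dflt // muln0 mulr0.
have fsym x y : f x y = f y x.
  by rewrite /f !invform_alpha gram_sym minnC mulnAC.
suff: 2^-1 * (\sum_(x \in Hset X l) \sum_(y \in Hset X l) f x y) \is a Num.int
  by [].
have us : uniq (finsupp m) := fset_uniq _.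
rewrite (@fsbig_supp_seq _ _ _ (finsupp m)) //; last first.
  move=> x xm; rewrite fsbig1 // => y _; rewrite fsym; exact: fm0.
under eq_bigr => x _ do
  rewrite (@fsbig_supp_seq _ _ _ (finsupp m) (f x) us (fm0 x)).
have f1 x y : f x y = (tv x.1)%:R *
    ((tv x.1)%:R^-1 * (invform (alpha x.1) (alpha y.1) *
                     (minn (t y.1 * x.2) (t x.1 * y.2))%:R)) * (m x * m y)%:R.
  by rewrite /f mulVKf ?tv_neq0 // -mulnA natrM mulrA.
apply: half_sym_sum_int => // [x|x y]; last first.
  rewrite f1; apply: rpredM; last exact: rpred_nat.
  by apply: rpredM; [exact: rpred_nat | exact: vacancy_coef_int].
rewrite /f invform_alpha mxE eqxx sqlenE minnn.
case: x => a i /=.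
have -> : (2 * tv a)%:R / (eps a * t a)%:R * (t a * i * m (a, i) * m (a, i))%:R
   / 2 = (tv a)%:R / (eps a)%:R * (i * m (a, i) * m (a, i))%:R :> rat.
  by rewrite !natrM; field; rewrite t_neq0 eps_neq0.
apply: rpredM; last exact: rpred_nat.
case: X a {l nu m f fm0 fsym us f1} => [n|n|n|n||||||n|n|n||] a;
  rewrite /eps //= /tv ?divr1; try exact: rpred_nat.
by case: ifP.
Qed.

Lemma admissible_finite (X : affine_type) (l : level) (nu : config X)
    (lam : weight X) : finite_set (admissible l nu lam).
Proof.
rewrite /admissible; set W := wiota _.
pose B := (\sum_a Num.truncn (W ord0 a))%N.
pose dec (g : {ffun node X * 'I_B.+1 -> 'I_B.+1}) : config X :=
  [fsfun x in [fset (a, val i) | a in node X, i in 'I_B.+1]%fset =>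
     val (g (x.1, inord x.2))].
apply: (@sub_finite_set _ _ (dec @` setT)); last exact/finite_image/finite_finset.
move=> m [m0 _ mW] /=.
have mH x : x \in finsupp m -> x \in Hset X l.
  by rewrite mem_finsupp => xm; apply: mem_set; apply: contrapT => xH; case/eqP: xm; apply: m0.
have mB x : (x.2 * m x <= B)%N.
  have [xm|xm] := boolP (x \in finsupp m); last by rewrite fsfun_dflt // muln0.
  apply: (@leq_trans (Num.truncn (W ord0 x.1))); last first.
    by rewrite /B (bigD1 x.1) //= leq_addr.
  rewrite -mW (@fsbig_supp_seq _ _ _ (finsupp m)) //; last first.
    by move=> y ym; rewrite fsfun_dflt // muln0 scale0r.
  have yge0 (y : node X * nat) : 0 <= ((y.2 * m y)%:R *: alpha y.1) 0 x.1 :> rat.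
    by rewrite !mxE mulr_ge0 ?ler0n.
  rewrite summxE truncn_ge_nat; last by apply: sumr_ge0.
  rewrite (big_rem x) //= (mH _ xm) !mxE !eqxx mulr1 lerDl.
  by apply: sumr_ge0.
have mS x : x \in finsupp m -> (x.2 <= B)%N /\ (m x <= B)%N.
  move=> xm; have [x2 _] := set_mem (mH _ xm).
  have mx : (0 < m x)%N by rewrite lt0n -mem_finsupp.
  split; apply: leq_trans (mB x); first exact: leq_pmulr.
  exact: leq_pmull.
exists [ffun y => inord (m (y.1, val y.2))] => //.
apply/fsfunP => -[a i]; rewrite /dec fsfun_fun.
case: ifP => [|/negP xS].
  case/imfset2P => c _ [j _ [-> ->]] /=; rewrite ffunE inord_val /= inordK //.
  rewrite ltnS; have [/mS[_ //]|xm] := boolP ((c, val j) \in finsupp m).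
  by rewrite fsfun_dflt.
have [xm|xm] := boolP ((a, i) \in finsupp m); last by rewrite fsfun_dflt.
have [/= iB _] := mS _ xm; case: xS; apply/imfset2P.
by exists a => //; exists (Ordinal (n:=B.+1) (m:=i) iB).
Qed.

(* Main.v *)
(* Write l = t_b l0 and let xi = t_b L iota(Lambda_b).  The kernel min(t_c j, t_a k)
   is the length of an intersection of intervals, so the quadratic part of the
   cocharge of m is a sum of square norms of vectors V_m(u), and completing the
   square shows that the least cocharge is c0, attained when V_m(u) = xi for
   u below l0 and V_m(u) = 0 above; that configuration has all its weight at
   the levels t_a l0.  For a general admissible m let m' be the part of m above
   the levels t_a l0, n the part below them reflected in these levels, and zeta_a
   the vacancy number at level t_a l0.  Then V_m' and xi - V_m (reversed) are the
   vectors of m' and n, the vacancy numbers of m are those of m' and n for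
   W(zeta), and m is admissible if and only if m' and n are.  The cocharge exceeds
   c0 by half the quadratic forms of m' and n, which is also the exponent
   obtained from m' and n when q is replaced by q^-1.  The q-binomials at the
   levels t_a l0 tend to 1 / (q_a)_{zeta_a}, since their multiplicities grow linearly in
   L, and only finitely many (zeta, m', n) have exponent below a given N. *)
From HB Require Import structures.
Require Import Defs.
From mathcomp Require Import all_boot all_order all_algebra.
From mathcomp Require Import finmap zify ring lra.
From mathcomp Require Import boolp classical_sets functions cardinality fsbigop.

Set Implicit Arguments.
Unset Strict Implicit.
Unset Printing Implicit Defensive.

Import Order.TTheory GRing.Theory Num.Theory.
Local Open Scope classical_set_scope.
Local Open Scope ring_scope.

(** Beyond the bookkeeping, two facts about the finite type carry the argument: the form is
    positive, and a vector pairing nonnegatively with all simple roots has nonnegative coordinates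
    ([coord_ge0]). Both are drawn from one explicit vector with positive image under the Gram
    matrix. The second fact is what makes the reflected part n exist: its multiplicity at the cut is
    what [x a] leaves over from the total of m, and this must not be negative. The values t_a are 1,
    2 or 3, so sixths are a common unit in which the cuts t_a l0 of all rows fall on the same cell 6
    l0. Once zeta is read off as a vacancy of m, the weight condition on n with weight 0 is
    automatic: it says that the vacancies of n at the cut vanish, which is also why that level
    contributes a q-binomial equal to 1. The two sides are never compared directly. For fixed L the
    left side, and for a finite set of zeta the right side, is a finite sum over triples (zeta, m',
    n); each is congruent modulo q^N to the sum over the finitely many triples of exponent below N,
    and the series is built from these sums. *)

(** * Positive vectors for the Gram matrices, type by type *)

Section GramRows.
Variable X : affine_type.
Implicit Types a c : node X.

Lemma sqlen_gt0 a : 0 < sqlen a.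
Proof.
have h : (0 < 2 * twist X)%N by case: (X).
have h' : (0 < lacing X)%N by case: (X).
by rewrite /sqlen; case: ifP => _; rewrite ?divr_gt0 ?ltr0n.
Qed.

Lemma gram_diag a : gram X a a = sqlen a.
Proof. by rewrite mxE eqxx. Qed.

Lemma gram_le0 a c : a != c -> gram X a c <= 0.
Proof.
move=> /negPf ac; rewrite mxE ac; case: ifP => // _.
by rewrite oppr_le0 divr_ge0 // le_max (ltW (sqlen_gt0 a)).
Qed.

Lemma gram_adj_lt0 a c : a != c -> adjacent a c -> gram X a c < 0.
Proof.
move=> /negPf ac adj; rewrite mxE ac adj.
by rewrite oppr_lt0 divr_gt0 // lt_max (sqlen_gt0 a).
Qed.

Lemma sum_label_le (k : nat) (g : nat -> rat) :
  0 <= g k -> \sum_(c : node X) (if label c == k then g (label c) else 0) <= g k.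
Proof.
move=> gk; rewrite -big_mkcond /=.
have [c /eqP ck|] := pickP (fun c : node X => label c == k).
  rewrite (big_pred1 c) ?ck // => d /=.
  by rewrite -ck /label eqSS.
by move=> h; rewrite big_pred0.
Qed.

(** The only possible neighbours of label [i] are [i.+1], [i.-1], [n] and [attach X]. Since
    off-diagonal terms only lower the sum, an inequality suffices, and it is not necessary to know
    that these candidates exist and are distinct. Positivity of a row becomes arithmetic in
    labels. *)
Lemma gram_row_ge a (sq w : nat -> rat) (n := rank X) (i := label a)
    (g := fun k => Num.max (sq i) (sq k) / 2 * w k) :
  (forall c, sqlen c = sq (label c)) -> (forall k, 0 <= sq k) ->
  (forall k, (k <= n)%N -> 0 <= w k) ->
  sq i * w i -
   ((if (i.+1 < n)%N then g i.+1 else 0) + (if (1 < i < n)%N then g i.-1 else 0)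
    + (if i == attach X then g n else 0)
    + (if (i == n) && (0 < attach X <= n)%N then g (attach X) else 0))
  <= \sum_c gram X a c * w (label c).
Proof.
move=> sqE sq0 w0.
have g0 k : (k <= n)%N -> 0 <= g k.
  by move=> kn; rewrite /g mulr_ge0 ?w0 // divr_ge0 // le_max sq0.
have lab c : (label c <= n)%N by exact: ltn_ord.
rewrite (bigD1 a) //= gram_diag sqE lerD2l.
pose h (k : nat) (p : bool) (c : node X) :=
  if p then (if label c == k then g (label c) else 0) else 0.
have hs k (p : bool) : (p -> (k <= n)%N) -> \sum_c h k p c <= (if p then g k else 0).
  rewrite /h; case: p => [/(_ isT) kn|_]; last by rewrite big1.
  by apply: sum_label_le; apply: g0.
have h0 k (p : bool) c : 0 <= h k p c.
  by rewrite /h; case: p => //; case: eqP => // _; apply: g0; apply: lab.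
rewrite lerNl -sumrN.
apply: (@le_trans _ _ (\sum_c (h i.+1 (i.+1 < n)%N c + h i.-1 (1 < i < n)%N c
   + h n (i == attach X) c + h (attach X) ((i == n) && (0 < attach X <= n)%N) c))).
  rewrite big_mkcond; apply: ler_sum => c _.
  have hh : 0 <= (h i.+1 (i.+1 < n)%N c + h i.-1 (1 < i < n)%N c
   + h n (i == attach X) c + h (attach X) ((i == n) && (0 < attach X <= n)%N) c).
    by rewrite !addr_ge0.
  case: ifPn => // ca.
  rewrite mxE eq_sym (negPf ca); case: ifPn => adj; last by rewrite mul0r oppr0.
  rewrite mulNr opprK !sqE -/i -/(g (label c)).
  move: adj; rewrite /adjacent /edge -/n -/i => /orP[] /orP[] /andP[/eqP e1 h2].
  - have -> : h i.+1 (i.+1 < n)%N c = g (label c) by rewrite /h e1 h2 eqxx.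
    by rewrite -!addrA lerDl !addr_ge0.
  - have -> : h n (i == attach X) c = g (label c) by rewrite /h e1 h2 eqxx.
    by rewrite -addrA addrC -addrA lerDl !addr_ge0.
  - have -> : h i.-1 (1 < i < n)%N c = g (label c).
      by rewrite /h h2 -e1 /= eqxx.
    by rewrite -!addrA addrCA lerDl !addr_ge0.
  - have -> : h (attach X) ((i == n) && (0 < attach X <= n)%N) c = g (label c).
      by rewrite /h h2 -e1 eqxx lab.
    by rewrite lerDr !addr_ge0.
rewrite !big_split /=; do 3?apply: lerD; apply: hs => //.
- exact: ltnW.
- by move=> _; apply/ltnW/ltn_ord.
- by case/and3P.
Qed.

End GramRows.

(* A vector whose image under the Gram matrix is positive: quadratic in the label
   along a chain (halved at the special end nodes), and for types E and F a multiple
   of the solution of [gram w = (1, ..., 1)]. *)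
Definition posvec (X : affine_type) (k : nat) : rat :=
  match X with
  | affC1 n | affA2odd n =>
      (if k == n then n%:R ^+ 2 / 2 else k%:R * (2 * n%:R - k%:R))
  | affD1 n =>
      (if (n.-1 <= k)%N then (n%:R ^+ 2 - 1) / 2 else k%:R * (2 * n%:R - k%:R))
  | affA1 n | affB1 n | affD2 n | affA2even n => k%:R * (2 * n%:R - k%:R)
  | affE61 => [:: 0; 8; 15; 21; 15; 8; 11]`_k
  | affE71 => [:: 0; 34; 66; 96; 75; 52; 27; 49]`_k
  | affE81 => [:: 0; 29; 57; 84; 110; 135; 91; 46; 68]`_k
  | affF41 => [:: 0; 11; 21; 30; 16]`_k
  | affE62 => [:: 0; 16; 30; 21; 11]`_k
  | affG21 => [:: 0; 4; 7]`_k
  | affD43 => [:: 0; 7; 4]`_k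
  end.

(** The predicate [short] moved from nodes to labels, so that square lengths at neighbouring labels
    can be evaluated without building ordinals. *)
Definition shortlabel (X : affine_type) (k : nat) : bool :=
  match X with
  | affB1 n | affD2 n | affA2even n => k == n
  | affC1 n | affA2odd n => k < n
  | affF41 => 2 < k
  | affE62 => k < 3
  | affG21 => 1 < k
  | affD43 => k < 2
  | _ => false
  end%N.

Definition sqlabel (X : affine_type) (k : nat) : rat :=
  if shortlabel X k then (2 * twist X)%:R / (lacing X)%:R else (2 * twist X)%:R.

Lemma sqlabelE (X : affine_type) (a : node X) : sqlen a = sqlabel X (label a).
Proof.
rewrite /sqlen /sqlabel; congr (if _ then _ else _).
by case: X a => [n|n|n|n||||||n|n|n||] a //; case: a => [[|[|[|[|?]]]] ?].
Qed.

Lemma sqlabel_ge0 X k : 0 <= sqlabel X k.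
Proof. by rewrite /sqlabel; case: ifP => _; rewrite ?divr_ge0. Qed.

Lemma sqlabel_lacing2 X : lacing X = 2%N ->
  exists2 s : rat, 0 < s &
    forall k, sqlabel X k = s * (if shortlabel X k then 1 else 2).
Proof.
move=> X2; exists (twist X)%:R; first by case: (X).
by move=> k; rewrite /sqlabel X2 natrM; case: ifP => _; [field | exact: mulrC].
Qed.

Lemma posvec_ge0 (X : affine_type) k :
  valid_type X -> (k <= rank X)%N -> 0 <= posvec X k.
Proof.
case: X => [n|n|n|n||||||n|n|n||] /= hX.
5,6,7,8,9,13,14: by move: k; do 9?[case=> //].
all: rewrite -(ler_nat rat) => kn; have k0 : (0 : rat) <= k%:R by [].
all: move: hX; rewrite -(ler_nat rat) => hX.
all: try case: ifP; nra.
Qed.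

Lemma gram_posvec (X : affine_type) (a : node X) : valid_type X ->
  0 < \sum_c gram X a c * posvec X (label c).
Proof.
move=> hX.
apply: lt_le_trans (gram_row_ge a (@sqlabelE X) (@sqlabel_ge0 X) (fun k => @posvec_ge0 X
  k hX)).
move: (ltn_ord a); rewrite /label; move: (nat_of_ord a) => i {a}.
case: X hX => [n|n|n|n||||||n|n|n||] hX.
5,6,7,8,9,13,14: by move: i; do 9?[case=> [|]; first by vm_compute].
all: match goal with |- context [sqlabel ?X _] =>
  have [s s_gt0 sE] := @sqlabel_lacing2 X (erefl _); rewrite !sE {sE} end.
all: rewrite -?maxr_pMr ?ltW //; move: hX => /=.
all: have [m12 m21] : Num.max 1 2 = 2 :> rat /\ Num.max 2 1 = 2 :> rat by [].
(* The shape of a row depends on the distance [j] to the last node, with 0, 1 and 2 special, and on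
   whether the node is the first one; this split decides every [if]. *)
all: move=> hX /subnKC; set j := (n - i.+1)%N => nE.
all: move: j nE hX => [|[|[|j]]] <- {n}; case: i => [|i] hX.
all: try (exfalso; lia).
all: repeat match goal with |- context [if ?b then _ else _] =>
  first [have -> : b = true by lia | have -> : b = false by lia] end.
all: rewrite ?maxxx ?m12 ?m21 ?addnK.
all: try have -> : ((i.+2 + 0).-1 = i.+1)%N by lia.
all: try have -> : ((i.+2 + 0) - 2 = i)%N by lia.
all: rewrite /= ?addn0.
all: try lra.
(* At the last node of type A the bound is [s] times n^2 + 1; the product of [s] with a square has
   to be supplied to [lra]. *)
all: try (have := mulr_ge0 (ltW s_gt0) (sqr_ge0 (i.+2%:R : rat)); lra).
Qed.

(** * Positivity and nondegeneracy of the invariant form *)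

Section InvariantForm.
Variable X : affine_type.
Implicit Types (u v w : qspan X) (a c : node X).

Lemma invformE u v : invform u v = \sum_a \sum_c u 0 a * gram X a c * v 0 c.
Proof.
rewrite /invform mxE exchange_big /=; apply: eq_bigr => c _.
by rewrite [v^T _ _]mxE [(u *m _) _ _]mxE mulr_suml.
Qed.

Lemma invformC u v : invform u v = invform v u.
Proof.
rewrite !invformE exchange_big /=; apply: eq_bigr => a _; apply: eq_bigr => c _.
by rewrite gram_sym; ring.
Qed.

Lemma invformDr u v w : invform u (v + w) = invform u v + invform u w.
Proof. by rewrite /invform linearD mulmxDr mxE. Qed.

Lemma invformZr k u v : invform u (k *: v) = k * invform u v.
Proof. by rewrite /invform linearZ -scalemxAr mxE. Qed.

Lemma invformNr u v : invform u (- v) = - invform u v.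
Proof. by rewrite -scaleN1r invformZr mulN1r. Qed.

Lemma invformBr u v w : invform u (v - w) = invform u v - invform u w.
Proof. by rewrite invformDr invformNr. Qed.

Lemma invform0r u : invform u 0 = 0.
Proof. by rewrite -(scale0r 0) invformZr mul0r. Qed.

Lemma invform_sumr (I : Type) (s : seq I) (P : pred I) (F : I -> qspan X) u :
  invform u (\sum_(i <- s | P i) F i) = \sum_(i <- s | P i) invform u (F i).
Proof.
by elim/big_ind2: _ => [|x1 x2 y1 y2 <- <-|//]; rewrite ?invform0r ?invformDr.
Qed.

Lemma invformBl u v w : invform (v - w) u = invform v u - invform w u.
Proof. by rewrite !(invformC _ u) invformBr. Qed.

Lemma invformZl k u v : invform (k *: v) u = k * invform v u.
Proof. by rewrite !(invformC _ u) invformZr. Qed.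

Lemma invform_suml (I : Type) (s : seq I) (P : pred I) (F : I -> qspan X) u :
  invform (\sum_(i <- s | P i) F i) u = \sum_(i <- s | P i) invform (F i) u.
Proof. by rewrite invformC invform_sumr; apply: eq_bigr => i _; exact: invformC. Qed.

Lemma invform_alphal a v : invform (alpha a) v = \sum_c gram X a c * v 0 c.
Proof.
rewrite invformE (bigD1 a) //= [X in _ + X]big1 ?addr0.
  by apply: eq_bigr => c _; rewrite mxE !eqxx mul1r.
by move=> d /negPf da; rewrite big1 // => c _; rewrite mxE da !mul0r.
Qed.

Lemma vec_sum_alpha v : v = \sum_a v 0 a *: alpha a.
Proof. exact: row_sum_delta. Qed.

Lemma invform_sum_alpha u v : invform u v = \sum_a u 0 a * invform (alpha a) v.
Proof.
rewrite {1}[u]vec_sum_alpha invform_suml.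
by apply: eq_bigr => a _; rewrite invformZl.
Qed.

(** If [w a] vanished, only the nonpositive off-diagonal terms of the row would remain. *)
Lemma gram_row_gt0_coord a (w : node X -> rat) :
  (forall c, 0 <= w c) -> 0 < \sum_c gram X a c * w c -> 0 < w a.
Proof.
move=> w0; rewrite (bigD1 a) //= [0 < w a]lt_def w0 andbT gram_diag; apply: contraTneq =>
  ->.
rewrite mulr0 add0r -leNgt; apply: sumr_le0 => c ca.
by rewrite mulr_le0_ge0 // gram_le0 // eq_sym.
Qed.

Hypothesis hX : valid_type X.

Let w a := posvec X (label a).

Let w_gt0 a : 0 < w a.
Proof.
apply: gram_row_gt0_coord; last exact: gram_posvec.
by move=> c; apply: posvec_ge0 => //; exact: ltn_ord.
Qed.

(** Put v_a = y_a w_a. Then (v|v) is the sum over a of w_a y_a^2 times the a-th entry of the image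
    of w, plus half the sum over a and c of -gram_ac w_a w_c (y_a - y_c)^2, and every term is
    nonnegative. *)
Lemma invform_ge0 v : 0 <= invform v v.
Proof.
pose y a := v 0 a / w a.
have vE a : v 0 a = y a * w a by rewrite /y divfK // gt_eqF.
suff : 2^-1 * (\sum_a \sum_c gram X a c * w c * (w a * y a ^+ 2)) +
    2^-1 * (\sum_a \sum_c gram X a c * w a * (w c * y c ^+ 2)) <= invform v v.
  have h : 0 <= \sum_a \sum_c gram X a c * w c * (w a * y a ^+ 2).
    apply: sumr_ge0 => a _; rewrite -mulr_suml.
    apply: mulr_ge0; first exact/ltW/gram_posvec.
    by rewrite mulr_ge0 ?sqr_ge0 ?(ltW (w_gt0 a)).
  apply: le_trans; rewrite addr_ge0 // mulr_ge0 // exchange_big /=.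
  by under eq_bigr => a _ do under eq_bigr => c _ do rewrite gram_sym.
rewrite !mulr_sumr -big_split invformE /=; apply: ler_sum => a _.
rewrite !mulr_sumr -big_split /=; apply: ler_sum => c _.
rewrite !vE; have [<-|ac] := eqVneq a c; first by lra.
have g0 : 0 <= - gram X a c by rewrite oppr_ge0 gram_le0.
have := mulr_ge0 (mulr_ge0 g0 (mulr_ge0 (ltW (w_gt0 a)) (ltW (w_gt0 c))))
  (sqr_ge0 (y a - y c)).
by lra.
Qed.

(* The coordinate minimising v_a / w_a, for a vector w with positive image under
   the Gram matrix, cannot be negative. *)
Lemma coord_ge0 v : (forall a, 0 <= invform (alpha a) v) -> forall a, 0 <= v 0 a.
Proof.
move=> hv a0.
have [a _ amin] := @arg_minP _ _ _ a0 xpredT (fun a => v 0 a / w a) isT.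
suff: 0 <= v 0 a / w a.
  by move/le_trans => /(_ _ (amin a0 isT)); rewrite pmulr_lge0 ?invr_gt0.
rewrite leNgt; apply/negP => va.
have := hv a; rewrite invform_alphal leNgt => /negP[].
apply: le_lt_trans (_ : v 0 a / w a * (\sum_c gram X a c * w c) < 0); last first.
  by rewrite nmulr_rlt0 ?gram_posvec.
rewrite mulr_sumr; apply: ler_sum => c _; rewrite mulrCA.
have [<-|ac] := eqVneq a c; first by rewrite divfK // gt_eqF.
by rewrite ler_wnM2l ?gram_le0 // -ler_pdivlMr ?amin.
Qed.

(** Both u - v and v - u satisfy the hypothesis of [coord_ge0]. This is nondegeneracy, and it makes
    the [invmx] in [fundw] a true inverse. *)
Lemma invform_alpha_inj u v :
  (forall a, invform (alpha a) u = invform (alpha a) v) -> u = v.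
Proof.
move=> uv; apply/rowP => a; apply/eqP; rewrite eq_le -subr_ge0 -[_ <= u 0 a]subr_ge0.
have h := @coord_ge0 (v - u); have h' := @coord_ge0 (u - v).
apply/andP; split.
  by have := h _ a; rewrite !mxE; apply=> c; rewrite invformBr uv subrr.
by have := h' _ a; rewrite !mxE; apply=> c; rewrite invformBr uv subrr.
Qed.

Lemma gram_unitmx : gram X \in unitmx.
Proof.
rewrite -row_free_unit -kermx_eq0; apply/eqP/row_matrixP => i.
rewrite row0; apply: invform_alpha_inj => a; rewrite invform0r invformC /invform.
by rewrite -row_mul mulmx_ker row0 mul0mx mxE.
Qed.

Lemma invform_alpha_fundw a c :
  invform (alpha a) (fundw c) = (a == c)%:R * (sqlen c / 2).
Proof.
rewrite /fundw invformZr mulrC invformC /invform -row_mul mulVmx ?gram_unitmx //.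
rewrite row1 /alpha trmx_delta -rowE mxE mxE.
by rewrite eqxx andbT eq_sym.
Qed.
End InvariantForm.

(** * Fundamental weights and connectedness of the Dynkin diagram *)

Section FundamentalWeights.
Variable X : affine_type.
Implicit Types (u v : qspan X) (a b c : node X) (mu : weight X).

Lemma wiotaB : {morph @wiota X : mu nu / mu - nu}.
Proof.
move=> mu nu; rewrite /wiota -sumrB; apply: eq_bigr => a _.
by rewrite -scalerBl -mulrBl !mxE rmorphB.
Qed.

HB.instance Definition _ :=
  GRing.isZmodMorphism.Build (weight X) (qspan X) (@wiota X) wiotaB.

Lemma wiota_fundwbar c : wiota (fundwbar c) = (eps c)%:R *: fundw c.
Proof.
rewrite /wiota (bigD1 c) //= big1 ?addr0; first by rewrite mxE !eqxx mul1r.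
by move=> a /negPf ac; rewrite mxE ac mul0r scale0r.
Qed.

Hypothesis hX : valid_type X.

Lemma invform_alpha_iota a c :
  invform (alpha a) (wiota (fundwbar c)) = (a == c)%:R * ((tv c)%:R / (t c)%:R).
Proof.
rewrite wiota_fundwbar invformZr invform_alpha_fundw // sqlenE !natrM.
by field; rewrite t_neq0 eps_neq0.
Qed.

Lemma coord_iota v a :
  v 0 a = (t a)%:R / (tv a)%:R * invform v (wiota (fundwbar a)).
Proof.
rewrite invform_sum_alpha (bigD1 a) //= big1 ?addr0.
  by rewrite invform_alpha_iota eqxx mul1r; field; rewrite t_neq0 tv_neq0.
by move=> c /negPf ca; rewrite invform_alpha_iota ca mul0r mulr0.
Qed.

Lemma t_gt0 a : (0 < t a)%N.
Proof. by rewrite lt0n -(eqr_nat rat) t_neq0. Qed.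

Lemma tv_gt0 a : (0 < tv a)%N.
Proof. by rewrite lt0n -(eqr_nat rat) tv_neq0. Qed.

Lemma attach_bounds : (1 < rank X)%N -> (0 < attach X < rank X)%N.
Proof.
by move: hX; case: (X) => //= n hn; lia.
Qed.

Lemma connected_nodes (P : set (node X)) :
  (forall a c, P a -> adjacent a c -> P c) -> forall a c, P a -> P c.
Proof.
move=> adjP.
(* Quantifying over the bound lets the induction run over naturals: [low] walks the chain up to the
   last node but one, and the last node is reached from [attach X], which covers the branching types
   D and E. *)
pose Q k := forall h : (k < rank X)%N, P (Ordinal h).
have lowE k : (k.+1 < (rank X).-1)%N -> Q k <-> Q k.+1.
  move=> kn; have h1 : (k.+1 < rank X)%N by lia.
  have h0 := ltnW h1.
  have adj : adjacent (Ordinal h0) (Ordinal h1).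
    by rewrite /adjacent /edge /label /= eqxx /=; apply/orP; left; apply/orP; left; lia.
  split=> Pk h; rewrite (bool_irrelevance h h1) || rewrite (bool_irrelevance h h0).
    exact: adjP (Pk h0) adj.
  by apply: adjP (Pk h1) _; rewrite /adjacent orbC.
have low k : (k < (rank X).-1)%N -> Q 0%N <-> Q k.
  elim: k => // k IH kn; rewrite IH; [exact: lowE | exact: ltnW].
have all0 a : Q 0%N <-> P a.
  have -> : P a <-> Q (a : nat).
    split=> [Pa h|/(_ (ltn_ord a))]; last by congr P; apply: val_inj.
    by have -> : Ordinal h = a by apply: val_inj.
  have [/low //|an] := ltnP a (rank X).-1.
  have aE : (a : nat) = (rank X).-1 by have := ltn_ord a; lia.
  have [r1|r1] := leqP (rank X) 1; first by have -> : (a : nat) = 0%N by lia.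
  have /andP[att0 attn] := attach_bounds r1.
  rewrite (low (attach X).-1); last by lia.
  rewrite aE.
  have h1 : ((rank X).-1 < rank X)%N by lia.
  have h0 : ((attach X).-1 < rank X)%N by lia.
  have adj : adjacent (Ordinal h0) (Ordinal h1).
    rewrite /adjacent /edge /label /= !prednK //; last by lia.
    by rewrite !eqxx !orbT.
  split=> Pk h; rewrite (bool_irrelevance h h1) || rewrite (bool_irrelevance h h0).
    exact: adjP (Pk h0) adj.
  by apply: adjP (Pk h1) _; rewrite /adjacent orbC.
by move=> a c /all0 /all0.
Qed.

(* The zero set of [wiota (fundwbar b)] is closed under adjacency: at a zero
   coordinate all the terms of the nonnegative pairing with [alpha a] are
   nonpositive. *)
Lemma iota_coord_gt0 b a : 0 < wiota (fundwbar b) 0 a.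
Proof.
set v := wiota _.
have av c : 0 <= invform (alpha c) v.
  by rewrite invform_alpha_iota mulr_ge0 ?divr_ge0.
have v0 := coord_ge0 hX av.
rewrite lt_def v0 andbT; apply/eqP => va0.
have vz : forall a c, v 0 a = 0 -> v 0 c = 0.
  apply: connected_nodes => {va0}a c va adj; have [<-//|ac] := eqVneq a c.
  have /eqP : \sum_(d | d != a) - (gram X a d * v 0 d) = 0.
    apply: le_anti; rewrite sumr_ge0 ?andbT.
      by move: (av a); rewrite invform_alphal (bigD1 a) //= va mulr0 add0r sumrN oppr_le0.
    by move=> d da; rewrite oppr_ge0 mulr_le0_ge0 // gram_le0 // eq_sym.
  rewrite psumr_eq0 => [/allP/(_ c)|d da]; last first.
    by rewrite oppr_ge0 mulr_le0_ge0 // gram_le0 // eq_sym.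
  rewrite mem_index_enum eq_sym ac oppr_eq0 mulf_eq0 lt_eqF ?gram_adj_lt0 //=.
  by move=> /(_ isT)/eqP.
have : invform (alpha b) v = 0.
  by rewrite invform_alphal big1 // => c _; rewrite (vz a c) ?mulr0.
move/eqP; rewrite invform_alpha_iota eqxx mul1r mulf_eq0 invr_eq0.
by rewrite (negPf (tv_neq0 b)) (negPf (t_neq0 b)).
Qed.

End FundamentalWeights.

(** * Valuation, completeness and limits of q-binomials *)

Section QAdic.
Implicit Types (x y : ratfun) (M N : int) (f g : {poly rat}).

Lemma q_neq0 : q != 0.
Proof. by rewrite tofrac_eq0 polyX_eq0. Qed.

Lemma poly_neq0_horner0 g : g.[0] != 0 -> g != 0.
Proof. by apply: contraNneq => ->; rewrite horner0. Qed.

Lemma qadic_small_frac f g : g.[0] != 0 -> qadic_small 0 (tofrac f / tofrac g).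
Proof. by move=> g0; exists f, g; rewrite expr0z mul1r. Qed.

Lemma qadic_small_poly f : qadic_small 0 (tofrac f).
Proof. by exists f, 1; rewrite hornerC oner_neq0 expr0z rmorph1 divr1 mul1r. Qed.

Lemma qadic_smallM M N x y :
  qadic_small M x -> qadic_small N y -> qadic_small (M + N) (x * y).
Proof.
move=> [f [g [g0 ->]]] [h [k [k0 ->]]]; exists (f * h), (g * k).
rewrite hornerM mulf_neq0 // !rmorphM /= expfzDr ?q_neq0 //; split=> //.
by rewrite mulrACA mulf_div.
Qed.

Lemma qadic_small_qX N : qadic_small N (q ^ N).
Proof. by exists 1, 1; rewrite hornerC oner_neq0 !rmorph1 divr1 mulr1. Qed.

Lemma qadic_smallMr N x y : qadic_small 0 x -> qadic_small N y -> qadic_small N (x * y).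
Proof. by rewrite -{2}[N]add0r; apply: qadic_smallM. Qed.

Lemma qadic_small_le M N x : M <= N -> qadic_small N x -> qadic_small M x.
Proof.
move=> MN [f [g [g0 ->]]]; exists ('X^(`|N - M|%N) * f), g; split=> //.
rewrite rmorphM rmorphXn /= -/q -[q ^+ _]/(q ^ Posz _) gez0_abs ?subr_ge0 //.
by rewrite !mulrA -expfzDr ?q_neq0 // subrKC.
Qed.

Lemma qadic_small0 N : qadic_small N 0.
Proof. by exists 0, 1; rewrite hornerC oner_neq0 rmorph0 mul0r mulr0. Qed.

Lemma qadic_smallD N x y : qadic_small N x -> qadic_small N y -> qadic_small N (x + y).
Proof.
move=> [f [g [g0 ->]]] [h [k [k0 ->]]]; exists (f * k + h * g), (g * k).
rewrite hornerM mulf_neq0 //; split=> //; rewrite rmorphD !rmorphM /=.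
by rewrite -mulrDr addf_div // tofrac_eq0 poly_neq0_horner0.
Qed.

Lemma qadic_smallN N x : qadic_small N x -> qadic_small N (- x).
Proof.
by move=> [f [g [g0 ->]]]; exists (- f), g; rewrite rmorphN mulNr mulrN.
Qed.

Lemma qadic_smallB N x y : qadic_small N x -> qadic_small N y -> qadic_small N (x - y).
Proof. by move=> hx /qadic_smallN; apply: qadic_smallD. Qed.

Lemma qadic_small_sum N (I : Type) (s : seq I) (P : pred I) (F : I -> ratfun) :
  (forall i, P i -> qadic_small N (F i)) -> qadic_small N (\sum_(i <- s | P i) F i).
Proof.
by move=> h; elim/big_ind: _ => //; [exact: qadic_small0 | exact: qadic_smallD].
Qed.

Lemma qadic_small1 : qadic_small 0 1.
Proof. by rewrite -(rmorph1 (@tofrac _)); exact: qadic_small_poly. Qed.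

Lemma qadic_small_prod (I : Type) (s : seq I) (P : pred I) (F : I -> ratfun) :
  (forall i, P i -> qadic_small 0 (F i)) -> qadic_small 0 (\prod_(i <- s | P i) F i).
Proof.
by move=> h; elim/big_ind: _ => //; [exact: qadic_small1 | exact: qadic_smallMr].
Qed.

Lemma qadic_cong_prod N (I : Type) (s : seq I) (P : pred I) (F G : I -> ratfun) :
  (forall i, P i -> qadic_small 0 (F i)) -> (forall i, P i -> qadic_small 0 (G i)) ->
  (forall i, P i -> qadic_small N (F i - G i)) ->
  qadic_small N (\prod_(i <- s | P i) F i - \prod_(i <- s | P i) G i).
Proof.
move=> F0 G0 FG; elim: s => [|i s IH]; first by rewrite !big_nil subrr; exact: qadic_small0.
rewrite !big_cons; case: ifP => // Pi.
set A := \prod_(j <- s | _) F j in IH *; set B := \prod_(j <- s | _) G j in IH *.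
have -> : F i * A - G i * B = F i * (A - B) + B * (F i - G i).
  by rewrite !mulrBr [B * G i]mulrC [B * F i]mulrC subrKA.
apply: qadic_smallD; apply: qadic_smallMr => //; last exact: FG.
  exact: F0.
exact: qadic_small_prod.
Qed.

(** With c = f(0) / g(0) the polynomial f - c g vanishes at 0, so a further factor X splits off. *)
Lemma qadic_leading N x : qadic_small N x ->
  exists c : rat, qadic_small (N + 1) (x - tofrac c%:P * q ^ N).
Proof.
move=> [f [g [g0 ->]]]; exists (f.[0] / g.[0]); set c := f.[0] / _.
have : root (f - c *: g) 0.
  by rewrite /root !hornerE /c divfK // subrr.
case/factor_theorem => h; rewrite subr0 => hE.
exists h, g; split=> //.
have g1 : tofrac g != 0 by rewrite tofrac_eq0 poly_neq0_horner0.
have fE : tofrac f = tofrac c%:P * tofrac g + tofrac h * q.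
  by rewrite -!rmorphM -rmorphD /= -hE mul_polyC addrC subrK.
rewrite fE expfzDr ?q_neq0 // expr1z mulrDl mulfK // mulrDr.
rewrite [tofrac c%:P * q ^ N]mulrC addrC addKr -[RHS]mulrA; congr (_ * _).
by rewrite mulrAC mulrC.
Qed.

Lemma qadic_complete (s : nat -> ratfun) :
  qadic_small 0 (s 0%N) ->
  (forall N : nat, qadic_small N%:Z (s N.+1 - s N)) ->
  exists2 S : laurent, pole S = 0%N & forall N : nat, qadic_near S N (s N).
Proof.
move=> s0 sS.
have /choice [c cP] : forall xN : ratfun * nat, exists c : rat,
    qadic_small xN.2%:Z xN.1 -> qadic_small xN.2.+1%:Z (xN.1 - tofrac c%:P * q ^ xN.2%:Z).
  move=> [x N] /=; have [h|h] := pselect (qadic_small N x); last by exists 0.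
  by have [c hc] := qadic_leading h; exists c => _; rewrite -addn1 PoszD.
(* [T] peels off one coefficient at a time: [s N.+1 - T N] has valuation at least N, and [c] reads
   its coefficient at q^N. The invariant is that [s N - T N] has valuation at least N. *)
pose T := fix T (N : nat) : ratfun :=
  if N is N'.+1 then T N' + tofrac (c (s N - T N', N'))%:P * q ^ N'%:Z else 0.
pose S := Laurent 0 (fun N : nat => c (s N.+1 - T N, N)).
exists S => // N; rewrite /qadic_near subr0.
have -> : truncation S N = T N.
  elim: N => [|N IH]; first by rewrite /truncation big_ord0.
  by rewrite /truncation big_ord_recr /= -IH subr0.
elim: N => [|N IH]; first by rewrite /= subr0.
rewrite /= opprD addrA; apply: (cP (s N.+1 - T N, N)) => /=.
by rewrite -(subrKA (s N)); apply: qadic_smallD.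
Qed.

Lemma horner0_one_subX (k : nat) : (0 < k)%N -> (1 - 'X^k : {poly rat}).[0] = 1.
Proof. by move=> k0; rewrite !hornerE expr0n eqn0Ngt k0 subr0. Qed.

Lemma one_sub_qX (k : nat) : 1 - q ^+ k = tofrac (1 - 'X^k).
Proof. by rewrite rmorphB rmorph1 rmorphXn. Qed.

Lemma one_sub_qX_neq0 (k : nat) : (0 < k)%N -> 1 - q ^+ k != 0.
Proof.
by move=> k0; rewrite one_sub_qX tofrac_eq0 poly_neq0_horner0 ?horner0_one_subX.
Qed.

Lemma qadic_small_qbinom (k p m : nat) : (0 < k)%N -> qadic_small 0 (qbinom (q ^+ k) p m).
Proof.
move=> k0; rewrite /qbinom big_nat_cond; apply: qadic_small_prod => i /andP[/andP[i0 _] _].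
rewrite -!exprM !one_sub_qX; apply: qadic_small_frac.
by rewrite horner0_one_subX ?muln_gt0 ?k0.
Qed.

Lemma qadic_small_qpochV (k p : nat) : (0 < k)%N -> qadic_small 0 (qpoch (q ^+ k) p)^-1.
Proof.
move=> k0; rewrite /qpoch -prodfV big_nat_cond.
apply: qadic_small_prod => i /andP[/andP[i0 _] _].
rewrite -!exprM one_sub_qX -[_^-1]mul1r -(rmorph1 (@tofrac _)).
by apply: qadic_small_frac; rewrite horner0_one_subX ?muln_gt0 ?k0.
Qed.

Lemma qpochD (F : fieldType) (x : F) (p m : nat) :
  qpoch x (p + m) = qpoch x p * \prod_(1 <= i < m.+1) (1 - x ^+ (p + i)).
Proof.
rewrite /qpoch -addnS (@big_cat_nat _ _ _ p.+1) //=; last by rewrite addnS ltnS leq_addr.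
congr (_ * _); rewrite -[in LHS]add1n big_addn addKn.
by apply: eq_bigr => i _; rewrite addnC.
Qed.

(** This exchanges the roles of p and m: the right side has a fixed number p of factors, each
    tending to 1 as m grows. *)
Lemma qbinomE (F : fieldType) (x : F) (p m : nat) :
  (forall i, (0 < i)%N -> 1 - x ^+ i != 0) ->
  qbinom x p m * qpoch x p = \prod_(1 <= i < p.+1) (1 - x ^+ (m + i)).
Proof.
move=> x1; have qpoch_neq0 k : qpoch x k != 0.
  by rewrite /qpoch big_nat_cond prodf_seq_neq0; apply/allP => i _; apply/implyP =>
    /andP[/andP[/x1]].
apply: (mulfI (qpoch_neq0 m)); rewrite -qpochD mulrCA mulrA addnC qpochD.
by rewrite mulrC; congr (_ * _); rewrite /qbinom big_split /= prodfV divfK // qpoch_neq0.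
Qed.

Lemma qadic_qbinom_lim (N k p m : nat) : (0 < k)%N -> (N <= m)%N ->
  qadic_small N (qbinom (q ^+ k) p m - (qpoch (q ^+ k) p)^-1).
Proof.
move=> k0 Nm; set x := q ^+ k.
have x1 i : (0 < i)%N -> 1 - x ^+ i != 0.
  by move=> i0; rewrite -exprM one_sub_qX_neq0 // muln_gt0 k0.
have P0 : qpoch x p != 0.
  by rewrite /qpoch big_nat_cond prodf_seq_neq0; apply/allP => i _; apply/implyP =>
    /andP[/andP[/x1]].
have -> : qbinom x p m - (qpoch x p)^-1 =
    (qpoch x p)^-1 * (\prod_(1 <= i < p.+1) (1 - x ^+ (m + i)) - \prod_(1 <= i < p.+1) 1).
  by rewrite -qbinomE // big1_eq mulrBr mulr1 mulrCA mulVf ?mulr1.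
apply: qadic_smallMr; first exact: qadic_small_qpochV.
apply: qadic_cong_prod => i _; rewrite -?exprM.
- by rewrite one_sub_qX; exact: qadic_small_poly.
- exact: qadic_small1.
rewrite addrAC subrr add0r; apply: qadic_smallN.
apply: (@qadic_small_le _ (k * (m + i))%N); last exact: qadic_small_qX.
by rewrite lez_nat (leq_trans Nm) // (leq_trans (leq_addr i m)) // leq_pmull.
Qed.

Lemma qbinomV (F : fieldType) (x : F) (p m : nat) : x != 0 ->
  qbinom x^-1 p m = x ^- (p * m) * qbinom x p m.
Proof.
move=> x0; rewrite /qbinom exprM -exprVn -exprVn.
have -> : (x^-1 ^+ p) ^+ m = \prod_(1 <= i < m.+1) x^-1 ^+ p.
  by rewrite prodr_const_nat subn1.
rewrite -big_split /=; apply: eq_big_nat => i _.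
have e k : 1 - x^-1 ^+ k = - (x^-1 ^+ k * (1 - x ^+ k)).
  by rewrite mulrBr mulr1 -exprMn mulVf // expr1n opprB.
rewrite !e invrN mulrNN invfM [x^-1 ^+ (p + i)]exprD [in LHS]mulrA [in RHS]mulrA; congr
  (_ / _).
by rewrite mulrC mulrA [x^-1 ^+ p * _]mulrC mulKf ?expf_neq0 ?invr_neq0.
Qed.

End QAdic.

(** * Levels measured in sixths; the kernel as a sum of square norms *)

Section Levels.
Variable X : affine_type.
Implicit Types (a b c : node X) (m nu : config X) (lev : level).

(** The cutoff [K] may vary with the row because the cuts [t a * l0] do. *)
Lemma fsbig_rect_dep (R : Type) (idx : R) (op : Monoid.com_law idx)
    (H : set (node X * nat)) (F : node X * nat -> R) (K : node X -> nat) :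
  (forall x, ~ H x \/ (K x.1 <= x.2)%N -> F x = idx) ->
  \big[op/idx]_(x \in H) F x = \big[op/idx]_a \big[op/idx]_(0 <= k < K a) F (a, k).
Proof.
move=> FK; pose r := [seq (a, k) | a <- enum 'I_(rank X), k <- index_iota 0 (K a)].
have ur : uniq r.
  by apply: allpairs_uniq_dep => [|a _|[a k] [c j] _ _ /= [-> ->]];
    rewrite ?enum_uniq ?iota_uniq.
transitivity (\big[op/idx]_(x \in [set` r]) F x).
  rewrite fsbig_mkcond [RHS]fsbig_mkcond; apply: eq_fsbigr => x _; rewrite /patch.
  case: ifPn => [|/negP] Hx; case: ifPn => [|/negP] xr //.
    apply: FK; right; rewrite leqNgt; apply/negP => xK; apply: xr; apply: mem_set.
    case: x xK {Hx} => a k kK.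
    by apply/allpairsPdep; exists a, k; rewrite mem_enum mem_index_iota.
  by apply/esym/FK; left => hx; apply: Hx; apply: mem_set.
rewrite -fsbig_seq // big_allpairs_dep big_enum /=.
by apply: eq_bigl => a; rewrite inE.
Qed.

Lemma fsbig_rect (R : Type) (idx : R) (op : Monoid.com_law idx)
    (H : set (node X * nat)) (F : node X * nat -> R) (K : nat) :
  (forall x, ~ H x \/ (K <= x.2)%N -> F x = idx) ->
  \big[op/idx]_(x \in H) F x = \big[op/idx]_a \big[op/idx]_(0 <= k < K) F (a, k).
Proof. exact: (@fsbig_rect_dep _ _ _ _ _ (fun=> K)). Qed.

Lemma fsbig_row (R : Type) (idx : R) (op : Monoid.com_law idx)
    (H : set nat) (F : nat -> R) (K : nat) :
  (forall k, ~ H k \/ (K <= k)%N -> F k = idx) ->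
  \big[op/idx]_(k \in H) F k = \big[op/idx]_(0 <= k < K) F k.
Proof.
move=> FK; rewrite [RHS]fsbig_seq ?iota_uniq //.
rewrite fsbig_mkcond [RHS]fsbig_mkcond; apply: eq_fsbigr => k _; rewrite /patch.
case: ifPn => [|/negP] Hk; case: ifPn => [|/negP] kr //.
  apply: FK; right; rewrite leqNgt; apply/negP => kK; apply: kr; apply: mem_set.
  by rewrite /= mem_index_iota.
by apply/esym/FK; left => hk; apply: Hk; apply: mem_set.
Qed.

(* The number of steps of size 1/6 in [1/t_a]: in these units the kernel
   [minn (t c * j) (t a * k)] is the common length of two intervals. *)
Definition cell a : nat := 6 %/ t a.

Lemma cellM a : (cell a * t a = 6)%N.
Proof. by rewrite /cell; case: (X) a => [n|n|n|n||||||n|n|n||] a; rewrite /t //; case: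
  ifP. Qed.

Lemma cell_gt0 a : (0 < cell a)%N.
Proof. by have := cellM a; case: (cell a). Qed.

Lemma minn_cell a c j k :
  (t a * (t c * minn (cell a * j) (cell c * k)) = 6 * minn (t c * j) (t a * k))%N.
Proof.
rewrite !minnMr; congr minn; first by rewrite -(cellM a); ring.
by rewrite -(cellM c); ring.
Qed.

Lemma sum_ltn_minn (P Q : nat) : (\sum_(0 <= u < P) (u < Q) = minn P Q)%N.
Proof.
elim: P => [|P IH]; first by rewrite big_geq ?min0n.
by rewrite big_nat_recr //= IH; lia.
Qed.

(** The bound is in cells, so that a single [U] serves rows with different [t a]. *)
Definition bounded m (U : nat) := forall a k, (U < cell a * k)%N -> m (a, k) = 0%N.

Lemma bounded_level m U a k : bounded m U -> (U < k)%N -> m (a, k) = 0%N.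
Proof. by move=> h Uk; apply: h; apply: leq_trans Uk (leq_pmull _ (cell_gt0 a)). Qed.

Definition depth m : nat := \max_(x <- finsupp m) cell x.1 * x.2.

Lemma bounded_depth m : bounded m (depth m).
Proof.
move=> a k; rewrite ltnNge => h.
apply/eqP; rewrite -[_ == _]negbK -mem_finsupp; apply: contra h => h.
exact: (@leq_bigmax_seq _ _ _ (fun x : node X * nat => cell x.1 * x.2)%N (a, k) h isT).
Qed.

Definition tail m a (u : nat) : nat :=
  \sum_(x <- finsupp m | (x.1 == a) && (u < cell a * x.2)%N) m x.

Lemma tailE m U K a u : bounded m U -> (U < K)%N ->
  tail m a u = (\sum_(0 <= k < K) (u < cell a * k) * m (a, k))%N.
Proof.
move=> mU UK.
transitivity (\sum_(x \in [set: node X * nat]) (x.1 == a) * (u < cell a * x.2) * m x)%N.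
  rewrite /tail (@fsbig_supp_seq _ _ _ (finsupp m)) ?fset_uniq //; last first.
    by move=> x xm; rewrite [m x]fsfun_dflt // muln0.
  rewrite big_mkcond [RHS]big_mkcond; apply: eq_bigr => x _; rewrite in_setT.
  by case: (_ == a) => //=; case: (_ < _)%N; rewrite ?mul1n.
rewrite (@fsbig_rect _ _ _ _ _ K); last first.
  move=> [c k] [h|/= kK]; [by case: h|rewrite (bounded_level _ mU) ?muln0 //].
  exact: leq_trans kK.
rewrite (bigD1 a) //=. rewrite [X in _ + X]big1 ?addr0.
  by apply: eq_bigr => k _; rewrite eqxx mul1n.
by move=> c /negPf ca; rewrite big1 // => k _; rewrite ca.
Qed.

Lemma tail_ge m U a u : bounded m U -> (U <= u)%N -> tail m a u = 0%N.
Proof.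
move=> mU Uu; rewrite (tailE _ _ mU (leqnn _)) big1 // => k _.
by case: ltnP => // /(leq_ltn_trans Uu)/mU ->.
Qed.

(** This is V_m(u) of the overview. The weights t_a are those of [minn_cell]: t_a t_c times the
    common length in cells is 6 times the kernel. *)
Definition profile m (u : nat) : qspan X := \row_a (t a * tail m a u)%:R.

Lemma profileE m u a : profile m u 0 a = (t a * tail m a u)%:R.
Proof. exact: mxE. Qed.

Lemma profile_ge m U u : bounded m U -> (U <= u)%N -> profile m u = 0.
Proof. by move=> mU Uu; apply/rowP => a; rewrite profileE mxE (tail_ge _ mU Uu) muln0. Qed.

Definition supported lev m := forall x, ~ Hset X lev x -> m x = 0%N.

Lemma sum_kernel_row lev m a i : supported lev m ->
  \sum_(y \in Hset X lev) invform (alpha a) (alpha y.1) *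
      (minn (t y.1 * i) (t a * y.2) * m y)%:R =
  (t a)%:R / 6 * \sum_(0 <= u < cell a * i) invform (alpha a) (profile m u).
Proof.
move=> mH; have mU := @bounded_depth m; set U := depth m in mU.
rewrite (@fsbig_rect _ _ _ _ _ U.+1); last first.
  case=> c k [/mH ->|/= Uk]; first by rewrite muln0 mulr0.
  by rewrite (bounded_level _ mU Uk) muln0 mulr0.
under [in RHS]eq_bigr do rewrite invform_alphal.
rewrite [in RHS]exchange_big /= mulr_sumr; apply: eq_bigr => c _.
under [in RHS]eq_bigr do rewrite profileE (tailE _ _ mU (leqnn _)) big_distrr natr_sum
  mulr_sumr /=.
rewrite [in RHS]exchange_big /= mulr_sumr; apply: eq_bigr => k _.
rewrite invform_alpha -mulr_sumr -natr_sum mulrCA; congr (_ * _).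
under [in RHS]eq_bigr do rewrite mulnCA.
rewrite -big_distrl /= sum_ltn_minn.
have e := minn_cell a c i k; apply: (mulfI (_ : (6 : rat) != 0)) => //.
by rewrite -natrM mulnA -e !natrM; field.
Qed.

Lemma sum_tail m U K a (P : nat) : bounded m U -> (U < K)%N ->
  (t a * \sum_(0 <= u < P) tail m a u =
    \sum_(0 <= k < K) t a * minn P (cell a * k) * m (a, k))%N.
Proof.
move=> mU UK; under eq_bigr do rewrite (tailE _ _ mU UK).
rewrite exchange_big /= big_distrr /=; apply: eq_bigr => k _.
by rewrite -mulnA -big_distrl /= sum_ltn_minn.
Qed.

(** The kernel counts, up to the factor of [minn_cell], the cells u below both endpoints. Summing
    over u last leaves one square norm per cell. *)
Lemma kernel_form lev m U : supported lev m -> bounded m U ->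
  \sum_(x \in Hset X lev) \sum_(y \in Hset X lev)
      invform (alpha x.1) (alpha y.1) *
      (minn (t y.1 * x.2) (t x.1 * y.2) * m x * m y)%:R =
  6^-1 * \sum_(0 <= u < U) invform (profile m u) (profile m u).
Proof.
move=> mH mU.
pose F (x : node X * nat) : rat := (m x)%:R * ((t x.1)%:R / 6 *
  \sum_(0 <= u < cell x.1 * x.2) invform (alpha x.1) (profile m u)).
transitivity (\sum_(x \in Hset X lev) F x).
  apply: eq_fsbigr => -[a i] _; rewrite /F /= -(sum_kernel_row a i mH).
  rewrite mulr_fsumr; apply: eq_fsbigr => y _ /=.
  by rewrite -mulnA mulnCA !natrM; ring.
rewrite (@fsbig_rect _ _ _ _ _ U.+1) /F; last first.
  case=> a k [/mH ->|/= Uk]; first by rewrite mul0r.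
  by rewrite (bounded_level _ mU Uk) mul0r.
under [in RHS]eq_bigr do rewrite invform_sum_alpha.
rewrite [in RHS]exchange_big /= mulr_sumr; apply: eq_bigr => a _.
under [in RHS]eq_bigr do rewrite profileE (tailE _ _ mU (leqnn _)) natrM natr_sum
  mulr_sumr mulr_suml /=.
rewrite [in RHS]exchange_big /= mulr_sumr; apply: eq_bigr => k _.
have [kU|/mU ->] := leqP (cell a * k) U; last first.
  by rewrite mul0r big1 ?mulr0 // => u _; rewrite muln0 mulr0 ?mul0r.
rewrite [in LHS](big_nat_widen _ _ _ _ _ kU) big_mkcond /= !mulr_sumr.
apply: eq_bigr => u _; case: (ltnP u _) => _; last by rewrite mul0n !(mulr0, mul0r).
by rewrite mul1n; ring.
Qed.

Lemma weight_form lev m U : supported lev m -> bounded m U ->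
  \sum_(x \in Hset X lev) (x.2 * m x)%:R *: alpha x.1 =
  6^-1 *: \sum_(0 <= u < U) profile m u.
Proof.
move=> mH mU.
rewrite (@fsbig_rect _ _ _ _ _ U.+1); last first.
  case=> a k [/mH ->|/= Uk]; first by rewrite muln0 scale0r.
  by rewrite (bounded_level _ mU Uk) muln0 scale0r.
rewrite [RHS]vec_sum_alpha; apply: eq_bigr => a _. rewrite /=.
rewrite -scaler_suml -natr_sum mxE summxE; congr (_ *: _).
under [in RHS]eq_bigr do rewrite profileE.
rewrite -natr_sum -big_distrr /= (sum_tail _ _ mU (leqnn _)).
apply: (mulfI (_ : (6 : rat) != 0)) => //; rewrite mulrA mulfV // mul1r -natrM.
congr _%:R; rewrite big_distrr /=; apply: eq_bigr => k _.
have [kU|/mU ->] := leqP (cell a * k) U; last by rewrite !muln0.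
by rewrite -(cellM a); ring.
Qed.

Lemma vacancyE lev nu m a i : supported lev m ->
  vacancy lev nu m (a, i) =
    \sum_(j \in [set j | Hset X lev (a, j)]) ((nu (a, j) * minn i j)%:R : rat) -
    (t a)%:R / (6 * (tv a)%:R) * \sum_(0 <= u < cell a * i) invform (alpha a) (profile m u).
Proof.
move=> mH; rewrite /vacancy /= sum_kernel_row //; congr (_ - _).
by rewrite mulrA; congr (_ * _); field; rewrite tv_neq0.
Qed.

(* Under [q -> q^-1] a q-binomial is multiplied by [q^-(p m)], so this identity
   turns the exponent of the inverted term into the energy. *)
Lemma cocharge_dual lev nu m U K : supported lev m -> supported lev nu ->
  bounded m U -> (U < K)%N ->
  cocharge lev nu m
    + \sum_a \sum_(0 <= i < K) (tv a)%:R * vacancy lev nu m (a, i) * (m (a, i))%:R =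
  - (12^-1 * \sum_(0 <= u < U) invform (profile m u) (profile m u)).
Proof.
move=> mH nuH mU UK; have nuV := @bounded_depth nu; set V := depth nu in nuV.
have mK a k : (K <= k)%N -> m (a, k) = 0%N.
  by move=> Kk; apply: (bounded_level _ mU); apply: leq_trans Kk.
set row := fun a => [set j : nat | Hset X lev (a, j)].
set A := \sum_a (tv a)%:R * \sum_(0 <= i < K) (m (a, i))%:R *
  \sum_(j \in row a) ((nu (a, j) * minn i j)%:R : rat).
set Q := \sum_(0 <= u < U) _.
have kerE : \sum_(x \in Hset X lev) \sum_(y \in Hset X lev)
      invform (alpha x.1) (alpha y.1) *
      (minn (t y.1 * x.2) (t x.1 * y.2) * m x * m y)%:R =
    \sum_a \sum_(0 <= i < K) (m (a, i))%:R * \sum_(y \in Hset X lev)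
      invform (alpha a) (alpha y.1) * (minn (t y.1 * i) (t a * y.2) * m y)%:R.
  rewrite (@fsbig_rect _ _ _ _ _ K) => [|[a k] h]; last first.
    apply: fsbig1 => y _; have -> : m (a, k) = 0%N by case: h => [/mH|/mK].
    by rewrite muln0 mul0n mulr0.
  apply: eq_bigr => a _; apply: eq_bigr => i _ /=.
  rewrite mulr_fsumr; apply: eq_fsbigr => y _ /=.
  by rewrite -mulnA mulnCA !natrM; ring.
have rowE : \sum_a (tv a)%:R *
      \sum_(j \in row a) \sum_(k \in row a) ((minn j k * nu (a, j) * m (a, k))%:R : rat)
        = A.
  apply: eq_bigr => a _; congr (_ * _).
  rewrite (@fsbig_row _ _ _ _ _ V.+1) => [|j h]; last first.
    apply: fsbig1 => y _.
    have -> : nu (a, j) = 0%N by case: h => [/nuH|/(bounded_level _ nuV)].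
    by rewrite muln0 mul0n.
  transitivity (\sum_(0 <= j < V.+1) \sum_(0 <= k < K)
      ((minn j k * nu (a, j) * m (a, k))%:R : rat)).
    apply: eq_bigr => j _; apply: fsbig_row => k h.
    by have -> : m (a, k) = 0%N by [case: h => [/mH|/mK]]; rewrite muln0.
  rewrite exchange_big /=; apply: eq_bigr => k _.
  rewrite (@fsbig_row _ _ _ _ _ V.+1) => [|j h]; last first.
    by have -> : nu (a, j) = 0%N by [case: h => [/nuH|/(bounded_level _ nuV)]].
  rewrite mulr_sumr; apply: eq_bigr => j _.
  by rewrite !natrM minnC; ring.
have vacE : \sum_a \sum_(0 <= i < K) (tv a)%:R * vacancy lev nu m (a, i) * (m (a, i))%:R
    = A - 6^-1 * Q.
  rewrite /Q -(kernel_form mH mU) kerE /A -sumrB; apply: eq_bigr => a _.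
  rewrite mulr_sumr -sumrB; apply: eq_bigr => i _; rewrite /vacancy /= mulrBr mulrBl.
  by rewrite mulVKf ?tv_neq0 // -!mulrA [_ * (m (a, i))%:R]mulrC; congr (_ - _); exact:
    mulrC.
(* The cocharge is Q/12 - A and the sum of tv p m is A - Q/6, so the linear part cancels and the
   quadratic part changes sign. *)
by rewrite vacE /cocharge rowE (kernel_form mH mU) -/Q; field.
Qed.

(** Half the quadratic form: 1/12 is the 1/2 of the cocharge times the 1/6 of [kernel_form]. The
    cutoff [depth m] is one choice; [energyE] allows any bound. *)
Definition energy m : rat :=
  12^-1 * \sum_(0 <= u < depth m) invform (profile m u) (profile m u).

Lemma sum_profile (V : nmodType) (F : qspan X -> V) m U : F 0 = 0 -> bounded m U ->
  \sum_(0 <= u < U) F (profile m u) = \sum_(0 <= u < depth m) F (profile m u).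
Proof.
move=> F0 mU; suff h W W' : bounded m W -> (W <= W')%N ->
    \sum_(0 <= u < W) F (profile m u) = \sum_(0 <= u < W') F (profile m u).
  have [/(h _ _ mU)//|/ltnW/(h _ _ (@bounded_depth m))->//] := leqP U (depth m).
move=> mW WW'; rewrite [RHS](@big_cat_nat _ _ _ W) //= [X in _ + X]big1_seq ?addr0 //.
by move=> u /andP[_]; rewrite mem_index_iota => /andP[Wu _]; rewrite (profile_ge mW Wu).
Qed.

Lemma energyE m U : bounded m U ->
  energy m = 12^-1 * \sum_(0 <= u < U) invform (profile m u) (profile m u).
Proof.
move=> mU; rewrite /energy (@sum_profile _ (fun v => invform v v) m U) //=.
exact: invform0r.
Qed.

End Levels.

Lemma sum_rev (V : nmodType) (P Q : nat) (F : nat -> V) : (P <= Q)%N ->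
  \sum_(0 <= u < P) F (Q - u.+1)%N + \sum_(0 <= u < Q - P) F u = \sum_(0 <= u < Q) F u.
Proof.
move=> PQ; rewrite addrC [RHS](@big_cat_nat _ _ _ (Q - P)) //= ?leq_subr //.
congr (_ + _); rewrite [RHS]big_nat_rev /= -{1}[(Q - P)%N]add0n [RHS]big_addn subKn //.
by apply: eq_big_nat => u uP; congr F; lia.
Qed.

(** * Cutting and reflecting configurations *)

Section Gluing.
Variables (X : affine_type) (l0 : nat).
Hypothesis l0_gt0 : (0 < l0)%N.
Implicit Types (a b c : node X) (m n : config X) (zeta : {ffun node X -> nat}) (lev :
  level).

(** As a level the cut depends on the row, but in cells it is always 6 l0 ([cell_top]), so all
    coordinates of a profile are cut together. *)
Definition top a : nat := t a * l0.

Lemma top_gt0 a : (0 < top a)%N.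
Proof. by rewrite muln_gt0 t_gt0. Qed.

Lemma cell_top a : (cell a * top a = 6 * l0)%N.
Proof. by rewrite /top mulnA cellM. Qed.

Lemma bounded_some m : supported (Some l0) m -> bounded m (6 * l0).
Proof.
move=> mH a k; rewrite -(cell_top a) ltn_pmul2l ?cell_gt0 // => topk.
by apply: mH => /= -[_]; rewrite leqNgt topk.
Qed.

Lemma WpowerE b (j L : nat) x : Wpower b j L x = ((x == (b, j)) * L)%N.
Proof. by rewrite /Wpower fsfun_fun inE; case: eqP => _; rewrite ?mul1n. Qed.

Lemma WzetaE (zeta : {ffun node X -> nat}) a j :
  Wzeta zeta (a, j) = ((j == 1%N) * zeta a)%N.
Proof.
rewrite /Wzeta fsfun_fun; case: ifPn => [/imfsetP[c _ [-> ->]]|].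
  by rewrite eqxx mul1n.
by case: eqP => // -> /imfsetP[]; exists a.
Qed.

Definition hasone lev := if lev is Some k then (0 < k)%N else true.

Lemma Hset_one lev a : hasone lev -> Hset X lev (a, 1%N).
Proof. by case: lev => [k|] //= k0; split=> //=; rewrite muln_gt0 t_gt0. Qed.

Lemma supported_Wzeta lev zeta : hasone lev -> supported lev (Wzeta zeta).
Proof.
move=> lev1 [a j] jH; rewrite WzetaE; case: eqP => // j1; case: jH.
by rewrite j1; exact: Hset_one.
Qed.

Lemma fsbig_row1 (H : set nat) (F : nat -> rat) (j : nat) :
  H j -> (forall k, k != j -> F k = 0) -> \sum_(k \in H) F k = F j.
Proof.
move=> Hj Fj; rewrite -[RHS](@fsbig_set1 _ _ +%R _ j F); apply/esym/fsbig_widen.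
  by move=> k ->.
by move=> k [_ /eqP kj]; exact: Fj.
Qed.

Lemma row_Wpower b L a i :
  \sum_(j \in [set j | Hset X None (a, j)]) ((Wpower b (top b) L (a, j) * minn i j)%:R :
    rat) =
  ((a == b) * L * minn i (top b))%:R.
Proof.
rewrite (@fsbig_row1 _ _ (top b)) //; last first.
  by move=> k /negPf kl; rewrite WpowerE xpair_eqE kl andbF.
- by split=> //; exact: top_gt0.
by rewrite WpowerE xpair_eqE eqxx andbT.
Qed.

Lemma row_Wzeta lev zeta a i : hasone lev -> (0 < i)%N ->
  \sum_(j \in [set j | Hset X lev (a, j)]) ((Wzeta zeta (a, j) * minn i j)%:R : rat) =
  (zeta a)%:R.
Proof.
move=> lev1 i0; rewrite (@fsbig_row1 _ _ 1) //; last first.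
  by move=> k /negPf kl; rewrite WzetaE kl.
- exact: Hset_one.
by rewrite WzetaE mul1n (minn_idPr i0) muln1.
Qed.

Lemma weight_Wpower b L :
  \sum_(x \in Hset X None) (fundwbar x.1 *+ (x.2 * Wpower b (top b) L x)) =
  fundwbar b *+ ((top b) * L).
Proof.
rewrite (@fsbig_rect _ _ _ _ _ _ (top b).+1).
  rewrite (bigD1 b) //= [X in _ + X]big1 ?addr0 => [|a /negPf ab]; last first.
    by rewrite big1 // => k _; rewrite WpowerE xpair_eqE ab muln0.
  rewrite big_nat_recr //= big1_seq ?add0r ?WpowerE ?eqxx ?mul1n // => k /andP[_].
  rewrite mem_index_iota => /andP[_ kl].
  by rewrite WpowerE xpair_eqE (ltn_eqF kl) andbF muln0.
move=> x h; rewrite WpowerE; case: eqP => [xb|_]; last by rewrite muln0.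
by case: h; rewrite xb /= ?ltnn //; case; split=> //; exact: top_gt0.
Qed.

Lemma weight_Wzeta lev zeta : hasone lev ->
  \sum_(x \in Hset X lev) (fundwbar x.1 *+ (x.2 * Wzeta zeta x)) =
  \sum_a fundwbar a *+ zeta a.
Proof.
move=> lev1; rewrite (@fsbig_rect _ _ _ _ _ _ 2).
  apply: eq_bigr => a _.
  by rewrite big_nat_recr //= big_nat1 !WzetaE !mul1n mul0n mulr0n add0r.
move=> [a k] h; rewrite WzetaE /=; case: eqP => [k1|_]; last by rewrite muln0.
by case: h => [[]|]; rewrite k1 //; exact: Hset_one.
Qed.


(* [m] agrees with [m'] shifted above the levels [top a] and with [n] reflected
   below them; the last condition encodes that [n (a, top a)] is the difference of
   [x a] and the total multiplicity of [m]. *)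
Record glued (x : node X -> nat) m m' n : Prop := Glued {
  glued_sup : supported None m;
  glued_sup' : supported None m';
  glued_supn : supported (Some l0) n;
  glued_low : forall a k, (0 < k < top a)%N -> m (a, k) = n (a, (top a - k)%N);
  glued_high : forall a k, (0 < k)%N -> m (a, (top a + k)%N) = m' (a, k);
  glued_top : forall a, (m (a, top a) + tail n a 0 + tail m' a 0 = x a)%N
}.

Lemma supported0 lev m a : supported lev m -> m (a, 0%N) = 0%N.
Proof. by move=> mH; apply: mH => -[]. Qed.

Section Profiles.
Variables (x : node X -> nat) (m m' n : config X).
Hypothesis mg : glued x m m' n.

Lemma glued_bounded U : bounded m' U -> bounded m (6 * l0 + U).
Proof.
move=> m'U a k Uk; have topk : (top a < k)%N.
  by rewrite -(ltn_pmul2l (cell_gt0 a)) cell_top; apply: leq_ltn_trans Uk; rewrite leq_addr.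
rewrite -(subnKC (ltnW topk)) (glued_high mg) ?subn_gt0 //; apply: m'U.
by rewrite mulnBr cell_top ltn_subRL.
Qed.

Lemma tail_high a u : tail m a (6 * l0 + u) = tail m' a u.
Proof.
have m'U := @bounded_depth X m'; set U := depth m' in m'U.
rewrite (@tailE _ m' U (U.+1) a u) // (@tailE _ m _ (top a + (6 * l0 + U).+1) _ _
  (glued_bounded m'U)); last first.
  by rewrite -[X in (X < _)%N]add0n -addSn leq_add ?top_gt0.
rewrite (@big_cat_nat _ _ _ (top a)) //= ?leq_addr // [X in (X + _)%N]big1_seq => [|k
  /andP[_]]; last first.
  rewrite mem_index_iota => /andP[_ ka].
  suff -> : (6 * l0 + u < cell a * k)%N = false by [].
  by apply/negbTE; rewrite -leqNgt -(cell_top a) (leq_trans (leq_mul (leqnn _) (ltnW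
    ka))) ?leq_addr.
rewrite add0n -{1}[top a]add0n big_addn addKn.
rewrite (@big_cat_nat _ _ _ U.+1) //= ?ltnS ?leq_addl // [X in (_ + X)%N]big1_seq ?addn0;
  last first.
  move=> k /andP[_]; rewrite mem_index_iota => /andP[Uk _].
  rewrite [(k + top a)%N]addnC (glued_high mg) ?(leq_trans _ Uk) //.
  by rewrite (bounded_level _ m'U Uk) muln0.
apply: eq_bigr => k _; rewrite mulnDr cell_top [(_ + 6 * l0)%N]addnC ltn_add2l.
case: (posnP k) => [->|k0]; first by rewrite muln0 ltn0.
by rewrite [(k + top a)%N]addnC (glued_high mg).
Qed.

(** A part of [m] at a level k strictly below the cut reappears in [n] at [top a - k], and exactly
    one of the two tails counts it: the first if u < cell a k, the second otherwise. The parts of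
    [m] at the cut and above, and of [n] at the cut, are counted for every u. *)
Lemma tail_low a u : (u < 6 * l0)%N -> (tail m a u + tail n a (6 * l0 - u.+1) = x a)%N.
Proof.
move=> ul.
have m'U := @bounded_depth X m'; set U := depth m' in m'U.
have t0 : (0 < top a)%N := top_gt0 a.
have nE v : tail n a v = (\sum_(1 <= k < top a) (v < cell a * k) * n (a, k) +
    (v < 6 * l0) * n (a, top a))%N.
  have nB := bounded_some (glued_supn mg).
  have [K KE] : exists K, K = (6 * l0 + top a).+1 by eexists.
  rewrite (@tailE _ n _ K _ _ nB) ?KE ?ltnS ?leq_addr //.
  rewrite (@big_cat_nat _ _ _ (top a).+1) //= ?ltnS ?leq_addl // [X in (_ + X)%N]big1_seq
    ?addn0; last first.
    move=> k /andP[_]; rewrite mem_index_iota => /andP[ak _].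
    by rewrite nB ?muln0 // -(cell_top a) ltn_pmul2l ?cell_gt0.
  by rewrite big_nat_recr //= cell_top big_ltn // muln0 ltn0 add0n.
have mE : tail m a u = (\sum_(1 <= k < top a) (u < cell a * k) * m (a, k) +
    m (a, top a) + tail m' a 0)%N.
  rewrite (@tailE _ m _ (top a + (6 * l0 + U).+1) _ _ (glued_bounded m'U)); last first.
    by rewrite -[X in (X < _)%N]add0n -addSn leq_add.
  rewrite (@big_cat_nat _ _ _ (top a)) //= ?leq_addr // big_ltn // muln0 ltn0 add0n -addnA.
  congr (_ + _)%N; rewrite -{1}[top a]add0n big_addn addKn.
  rewrite big_ltn // add0n cell_top ul mul1n; congr (_ + _)%N.
  rewrite (@tailE _ m' U (6 * l0 + U).+1) ?ltnS ?leq_addl // [RHS]big_ltn // muln0 ltn0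
    add0n.
  apply: eq_big_nat => k /andP[k0 _]; rewrite [(k + top a)%N]addnC (glued_high mg) //.
  rewrite muln_gt0 cell_gt0 k0 mulnDr cell_top.
  by rewrite (leq_trans ul) ?leq_addr.
have l6 : (0 < 6 * l0)%N by rewrite muln_gt0.
rewrite mE !nE -(glued_top mg a) nE ltn_subrL l6 /=.
have -> : (\sum_(1 <= k < top a) (u < cell a * k) * m (a, k) =
   \sum_(1 <= k < top a) (u < 6 * l0 - cell a * k) * n (a, k))%N.
  rewrite big_nat_rev /=; apply: eq_big_nat => k /andP[k0 ka].
  have e : (1 + top a - k.+1 = top a - k)%N by lia.
  by rewrite e mulnBr cell_top (glued_low mg) ?subKn ?(ltnW ka) //; lia.
have e : (\sum_(1 <= k < top a) (u < 6 * l0 - cell a * k) * n (a, k) +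
    \sum_(1 <= k < top a) (6 * l0 - u.+1 < cell a * k) * n (a, k) =
    \sum_(1 <= k < top a) (0 < cell a * k) * n (a, k))%N.
  rewrite -big_split /=; apply: eq_big_nat => k /andP[k0 ka].
  rewrite -mulnDl muln_gt0 cell_gt0 k0; congr (_ * _)%N.
  have : (cell a * k < 6 * l0)%N by rewrite -(cell_top a) ltn_pmul2l ?cell_gt0.
  by case: ltnP; case: ltnP => //=; lia.
by rewrite -e; ring.
Qed.

End Profiles.

End Gluing.

(** * Cocharge, vacancies and weight of a glued configuration *)

Section GluedForm.
Variables (X : affine_type) (b : node X) (l0 L : nat).
Hypothesis hX : valid_type X.
Hypothesis l0_gt0 : (0 < l0)%N.
Variable x : node X -> nat.
Let xi : qspan X := (t b * L)%:R *: wiota (fundwbar b).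
Hypothesis xE : forall a, xi 0 a = (t a * x a)%:R.
Implicit Types (a c : node X) (zeta : {ffun node X -> nat}) (lev : level).

Let l := top l0 b.

Variables (m m' n : config X).
Hypothesis mg : glued l0 x m m' n.

Lemma profile_high u : profile m (6 * l0 + u) = profile m' u.
Proof. by apply/rowP => a; rewrite !profileE (tail_high l0_gt0 mg). Qed.

Lemma profile_low u : (u < 6 * l0)%N -> profile m u = xi - profile n (6 * l0 - u.+1).
Proof.
move=> ul; apply/rowP => a; rewrite [RHS]mxE [X in _ + X]mxE xE !profileE.
by rewrite -(tail_low l0_gt0 mg a ul) mulnDr natrD addrK.
Qed.

Let nB : bounded n (6 * l0) := bounded_some (glued_supn mg).

Lemma sum_profile_glued (V : zmodType) (F : qspan X -> V) U : bounded m' U ->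
  \sum_(0 <= u < 6 * l0 + U) F (profile m u) =
  \sum_(0 <= u < 6 * l0) F (xi - profile n u) + \sum_(0 <= u < U) F (profile m' u).
Proof.
move=> m'U; rewrite (@big_cat_nat _ _ _ (6 * l0)) //= ?leq_addr //; congr (_ + _).
  rewrite big_nat_rev /= add0n; apply: eq_big_nat => u /andP[_ ul].
  by rewrite profile_low; [congr (F (_ - profile n _)); lia | lia].
rewrite -{1}[(6 * l0)%N]add0n big_addn addKn; apply: eq_bigr => u _.
by rewrite addnC profile_high.
Qed.

Lemma invform_xi v : invform xi v = L%:R * (tv b)%:R * v 0 b.
Proof.
rewrite /xi invformZl invformC coord_iota // natrM.
by field; rewrite tv_neq0.
Qed.

Lemma invform_alpha_xi a : invform (alpha a) xi = (a == b)%:R * (L * tv b)%:R.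
Proof.
rewrite /xi invformZr invform_alpha_iota // !natrM; case: (a == b); rewrite ?mul0r ?mulr0
  // !mul1r.
by field; rewrite t_neq0.
Qed.

Let c0 : rat := - (L%:R ^+ 2 * l%:R * (t b)%:R
       * invform (wiota (fundwbar b)) (wiota (fundwbar b)) / 2).

Lemma cocharge_glued :
  cocharge None (Wpower b l L) m = c0 + energy m' + energy n.
Proof.
have m'U := @bounded_depth X m'; set U := depth m' in m'U.
have mU := glued_bounded mg m'U.
rewrite /cocharge (kernel_form (glued_sup mg) mU) (energyE m'U) (energyE nB).
(* Only row b contributes; up to scaling, [minn k l] counts the cells below 6 l0 covered by level k,
   and pairing with xi reads off coordinate b ([invform_xi]). *)
have -> : \sum_a (tv a)%:R * \sum_(j \in [set j | Hset X None (a, j)])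
    \sum_(k \in [set j | Hset X None (a, j)])
      ((minn j k * Wpower b l L (a, j) * m (a, k))%:R : rat) =
  6^-1 * \sum_(0 <= u < 6 * l0) invform xi (profile m u).
  rewrite (bigD1 b) //= [X in _ + X]big1 ?addr0 => [|a /negPf ab]; last first.
    rewrite fsbig1 ?mulr0 // => j _; rewrite fsbig1 // => k _.
    by rewrite WpowerE xpair_eqE ab muln0 mul0n.
  rewrite (@fsbig_row1 _ _ l); last first.
  - move=> j /negPf jl; rewrite fsbig1 // => k _.
    by rewrite WpowerE xpair_eqE jl andbF muln0 mul0n.
  - by split=> //; exact: top_gt0.
  rewrite (@fsbig_row _ _ _ _ _ (6 * l0 + U).+1) => [|k h]; last first.
    suff -> : m (b, k) = 0%N by rewrite muln0.
    by case: h => [/(glued_sup mg)|/(bounded_level _ mU)].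
  under [in RHS]eq_bigr do rewrite invform_xi profileE.
  rewrite -[in RHS]mulr_sumr -[in RHS]natr_sum -[in RHS]big_distrr /= (sum_tail _ _ mU
    (leqnn _)).
  rewrite natr_sum !mulr_sumr; apply: eq_bigr => k _.
  rewrite WpowerE eqxx mul1n -[(6 * l0)%N](cell_top l0 b) -minnMr mulnA [(t b *
    _)%N]mulnC cellM.
  by rewrite !natrM; field.
rewrite (@sum_profile_glued _ (fun v => invform v v)) //=.
have -> : \sum_(0 <= u < 6 * l0) invform xi (profile m u) =
   \sum_(0 <= u < 6 * l0) invform xi (xi - profile n u).
  rewrite big_nat_rev /= add0n; apply: eq_big_nat => u /andP[_ ul].
  by rewrite profile_low; [congr (invform _ (_ - profile n _)); lia | lia].
(* The constant of the completed square is 6 l0 copies of (xi|xi)/12. The norm of xi brings t_b^2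
   and l0 is l / t_b, which leaves a factor [t b] in the numerator of [c0]. *)
have -> : c0 = - (12^-1 * \sum_(0 <= u < 6 * l0) invform xi xi).
  rewrite sumr_const_nat subn0 /xi invformZr invformZl -mulr_natl.
  by rewrite /c0 /l /top !natrM; field.
have -> : \sum_(0 <= u < 6 * l0) invform (xi - profile n u) (xi - profile n u) =
   2 * (\sum_(0 <= u < 6 * l0) invform xi (xi - profile n u)) -
   \sum_(0 <= u < 6 * l0) invform xi xi +
   \sum_(0 <= u < 6 * l0) invform (profile n u) (profile n u).
  rewrite mulr_sumr -sumrB -big_split; apply: eq_bigr => u _ /=.
  by rewrite !invformBr !invformBl (invformC (profile n u) xi); ring.
by field.
Qed.

Variable zeta : {ffun node X -> nat}.
(** The factor of the quadratic term in [vacancyE]. The hypothesis [zetaE] says that n has vacancy 0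
    at the cut for W(zeta); equivalently, m has vacancy [zeta a] there ([vacancy_glued_top]). *)
Let coef a : rat := (t a)%:R / (6 * (tv a)%:R).
Hypothesis zetaE : forall a, (zeta a)%:R =
  coef a * \sum_(0 <= u < 6 * l0) invform (alpha a) (profile n u).

(** Up to the cut this equals the contribution of W to the vacancy, so replacing profiles of m by
    those of xi minus n cancels W. *)
Lemma coef_xi a i : coef a * ((cell a * i)%:R * invform (alpha a) xi) =
  ((a == b) * L * i)%:R.
Proof.
rewrite invform_alpha_xi; have [->|_] := eqVneq a b; last by rewrite mul0r !mulr0.
have c6 : (cell b)%:R = 6 / (t b)%:R :> rat.
  have h : (cell b)%:R * (t b)%:R = 6 :> rat by rewrite -natrM cellM.
  by rewrite -h mulfK ?t_neq0.
by rewrite mul1r mul1n !natrM c6 /coef; field; rewrite t_neq0 tv_neq0.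
Qed.

Lemma vacancy_low a i : (0 < i <= top l0 a)%N ->
  vacancy None (Wpower b l L) m (a, i) =
  coef a * \sum_(0 <= u < cell a * i) invform (alpha a) (profile n (6 * l0 - u.+1)).
Proof.
case/andP=> i0 ia; rewrite vacancyE; last exact: (glued_sup mg).
rewrite row_Wpower // -/(coef a).
have ci : (cell a * i <= 6 * l0)%N by rewrite -(cell_top l0 a) leq_mul2l ia orbT.
have -> : \sum_(0 <= u < cell a * i) invform (alpha a) (profile m u) =
    (cell a * i)%:R * invform (alpha a) xi -
    \sum_(0 <= u < cell a * i) invform (alpha a) (profile n (6 * l0 - u.+1)).
  rewrite mulr_natl -[X in _ *+ X]subn0 -sumr_const_nat -sumrB.
  apply: eq_big_nat => u /andP[_ ui]; rewrite -invformBr -profile_low //.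
  exact: leq_trans ci.
rewrite mulrBr coef_xi; have [ab|_] := eqVneq a b; last by rewrite !mul0n sub0r add0r opprK.
have -> : minn i l = i by apply/minn_idPl; rewrite /l -ab.
by rewrite opprB addrC subrK.
Qed.

Lemma vacancy_restricted a j : (0 < j)%N ->
  vacancy (Some l0) (Wzeta zeta) n (a, j) =
  (zeta a)%:R - coef a * \sum_(0 <= u < cell a * j) invform (alpha a) (profile n u).
Proof.
by move=> j0; rewrite vacancyE ?row_Wzeta //; exact: (glued_supn mg).
Qed.

(** [zeta a] is the sum over all 6 l0 cells of n, so the partial sum from the far end is [zeta a]
    minus the complementary partial sum from 0. *)
Lemma vacancy_reflect a i : (0 < i < top l0 a)%N ->
  vacancy None (Wpower b l L) m (a, i) =
  vacancy (Some l0) (Wzeta zeta) n (a, top l0 a - i)%N.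
Proof.
case/andP=> i0 ia; have ia' := ltnW ia.
rewrite vacancy_low ?i0 // vacancy_restricted ?subn_gt0 //.
have ci : (cell a * i <= 6 * l0)%N by rewrite -(cell_top l0 a) leq_mul2l ia' orbT.
rewrite zetaE -mulrBr -(sum_rev (fun u => invform (alpha a) (profile n u)) ci).
by rewrite mulnBr cell_top addrK.
Qed.

Lemma vacancy_glued_top a :
  vacancy None (Wpower b l L) m (a, top l0 a) = (zeta a)%:R.
Proof.
rewrite vacancy_low ?top_gt0 ?leqnn // zetaE cell_top.
rewrite -(sum_rev (fun u => invform (alpha a) (profile n u)) (leqnn _)).
by rewrite subnn [X in _ + X]big_geq ?addr0.
Qed.

Lemma vacancy_restricted_top a :
  vacancy (Some l0) (Wzeta zeta) n (a, top l0 a) = 0.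
Proof. by rewrite vacancy_restricted ?top_gt0 // cell_top zetaE subrr. Qed.

Lemma vacancy_high a i : (0 < i)%N ->
  vacancy None (Wpower b l L) m (a, top l0 a + i)%N =
  vacancy None (Wzeta zeta) m' (a, i).
Proof.
move=> i0; rewrite !vacancyE; [|exact: (glued_sup' mg)|exact: (glued_sup mg)].
rewrite row_Wzeta // -vacancy_glued_top vacancyE; last exact: (glued_sup mg).
rewrite !row_Wpower // -!/(coef a) mulnDr cell_top.
rewrite [X in coef a * X](@big_cat_nat _ _ _ (6 * l0)) //= ?leq_addr // mulrDr opprD addrA.
congr (_ - _ - _).
  by have [->|_] := eqVneq a b; rewrite ?mul0n // minnn (minn_idPr _) ?leq_addr.
congr (_ * _); rewrite -{1}[(6 * l0)%N]add0n big_addn addKn; apply: eq_bigr => u _.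
by rewrite addnC profile_high.
Qed.

(** Paired with the simple roots, this weight condition is [zetaE]; as simple roots separate
    vectors, it holds without further constraint on n. *)
Lemma restricted_weight :
  \sum_(x \in Hset X (Some l0)) (x.2 * n x)%:R *: alpha x.1 =
  \sum_a (zeta a)%:R *: wiota (fundwbar a).
Proof.
rewrite (weight_form (glued_supn mg) nB); apply: (invform_alpha_inj hX) => a.
rewrite invformZr !invform_sumr [RHS](bigD1 a) //= [X in _ = _ + X]big1 => [|c /negPf ca].
  rewrite addr0 invformZr invform_alpha_iota // eqxx mul1r zetaE /coef.
  by field; rewrite tv_neq0 t_neq0.
by rewrite invformZr invform_alpha_iota // eq_sym ca mul0r mulr0.
Qed.

Lemma wiota_Wzeta (lam : weight X) lev : hasone lev ->
  wiota (\sum_(x \in Hset X lev) (fundwbar x.1 *+ (x.2 * Wzeta zeta x)) - lam) =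
  \sum_a (zeta a)%:R *: wiota (fundwbar a) - wiota lam.
Proof.
move=> lev1; rewrite weight_Wzeta // raddfB raddf_sum; congr (_ - _).
by apply: eq_bigr => a _; rewrite raddfMn /= scaler_nat.
Qed.

(** The 6 l0 copies of xi account for the weight of W, and the reflected n subtracts the weight of
    W(zeta). *)
Lemma glued_weight :
  \sum_(x \in Hset X None) (x.2 * m x)%:R *: alpha x.1 +
  \sum_a (zeta a)%:R *: wiota (fundwbar a) =
  wiota (fundwbar b *+ (l * L)) +
  \sum_(x \in Hset X None) (x.2 * m' x)%:R *: alpha x.1.
Proof.
have m'U := @bounded_depth X m'; set U := depth m' in m'U.
rewrite -restricted_weight (weight_form (glued_supn mg) nB).
rewrite (weight_form (glued_sup' mg) m'U) (weight_form (glued_sup mg) (glued_bounded mg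
  m'U)).
rewrite (sum_profile_glued id m'U) /= sumrB sumr_const_nat subn0 raddfMn /=.
rewrite -!scalerDr addrAC subrK scalerDr; congr (_ + _).
rewrite /xi -!scaler_nat !scalerA; congr (_ *: _).
by rewrite /l /top !natrM; field.
Qed.

Lemma glued_admissible (lam : weight X) :
  admissible None (Wpower b l L) lam m <->
  admissible None (Wzeta zeta) lam m' /\ admissible (Some l0) (Wzeta zeta) 0 n.
Proof.
have nw : \sum_(x \in Hset X (Some l0)) (x.2 * n x)%:R *: alpha x.1 =
  wiota (\sum_(x \in Hset X (Some l0)) (fundwbar x.1 *+ (x.2 * Wzeta zeta x)) - 0).
  by rewrite wiota_Wzeta // raddf0 subr0 restricted_weight.
have mw : \sum_(x \in Hset X None) (x.2 * m x)%:R *: alpha x.1 =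
    wiota (\sum_(x \in Hset X None) (fundwbar x.1 *+ (x.2 * Wpower b l L x)) - lam) <->
    \sum_(x \in Hset X None) (x.2 * m' x)%:R *: alpha x.1 =
    wiota (\sum_(x \in Hset X None) (fundwbar x.1 *+ (x.2 * Wzeta zeta x)) - lam).
  rewrite wiota_Wzeta // weight_Wpower // raddfB /=.
  have := glued_weight; set A := \sum_(x \in _) _; set B := \sum_(x \in _) _.
  set C := \sum_a _; set D := wiota (_ *+ _); set W := wiota lam => e.
  split=> [h|h]; first by apply: (addrI D); rewrite -e h addrAC addrA.
  by apply: (addIr C); rewrite e h addrA addrAC.
split=> [[_ vac w]|[[_ vac' w'] [_ vacn _]]].
- split; split=> //; [exact: (glued_sup' mg)| | exact/mw|exact: (glued_supn mg)|].
    by move=> [a i] [/= i0 _]; rewrite -vacancy_high // vac //; split=> //=; rewrite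
      addn_gt0 i0 orbT.
  move=> [a i] [/= i0 ia]; rewrite -/(top l0 a) in ia.
  have [->|ia'] := eqVneq i (top l0 a); first by rewrite vacancy_restricted_top.
  have {}ia : (i < top l0 a)%N by rewrite ltn_neqAle ia'.
  have := @vacancy_reflect a (top l0 a - i); rewrite subKn ?(ltnW ia) // => <-.
    by apply: vac; split=> //=; rewrite subn_gt0.
  by rewrite subn_gt0 ia ltn_subrL i0 (leq_ltn_trans _ ia).
split; [exact: (glued_sup mg)| |exact/mw].
move=> [a i] [/= i0 _]; have [ia|ia|->] := ltngtP i (top l0 a).
- rewrite vacancy_reflect ?i0 // vacn //; split=> /=; first by rewrite subn_gt0.
  by rewrite -/(top l0 a) leq_subr.
- rewrite -(subnKC (ltnW ia)) vacancy_high ?subn_gt0 // vac' //.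
  by split=> //=; rewrite subn_gt0.
- by rewrite vacancy_glued_top.
Qed.

End GluedForm.

(** * Existence and uniqueness of the pieces *)

Section GluingMaps.
Variables (X : affine_type) (l0 : nat).
Hypothesis l0_gt0 : (0 < l0)%N.
Implicit Types (a c : node X) (m n : config X) (zeta : {ffun node X -> nat}) (lev : level).

Lemma config_of (f : node X * nat -> nat) (K : nat) :
  (forall a k, (K <= k)%N -> f (a, k) = 0%N) -> exists m : config X, forall y, m y = f y.
Proof.
move=> fK; exists [fsfun y in [fset (a, val i) | a in node X, i in 'I_K]%fset => f y] => y.
rewrite fsfun_fun; case: ifPn => // /negP yS; case: y yS => a k yS.
have [/fK -> //|kK] := leqP K k.
by case: yS; apply/imfset2P; exists a => //; exists (Ordinal kK).
Qed.

Lemma tail0E m U K a : bounded m U -> (U < K)%N ->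
  tail m a 0 = (\sum_(1 <= k < K) m (a, k))%N.
Proof.
move=> mU UK; rewrite (tailE a 0 mU UK) big_ltn ?(leq_ltn_trans _ UK) // muln0 ltn0 add0n.
by apply: eq_big_nat => k /andP[k0 _]; rewrite muln_gt0 cell_gt0 k0 mul1n.
Qed.

Lemma glued_ex (x : node X -> nat) m' n :
  supported None m' -> supported (Some l0) n ->
  (forall a, (tail n a 0 + tail m' a 0 <= x a)%N) -> exists m, glued l0 x m m' n.
Proof.
move=> m's ns xb; have m'U := @bounded_depth X m'; set U := depth m' in m'U.
pose f (y : node X * nat) : nat := let: (a, k) := y in
  if k == 0%N then 0%N else if (k < top l0 a)%N then n (a, (top l0 a - k)%N)
  else if k == top l0 a then (x a - (tail n a 0 + tail m' a 0))%N
  else m' (a, (k - top l0 a)%N).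
have [|m mE] := @config_of f (6 * l0 + U).+1.
  move=> a k Uk; have ak : (top l0 a < k - U)%N.
    have := leq_pmull (top l0 a) (cell_gt0 a); rewrite cell_top; lia.
  rewrite /f; case: eqP => // _; case: ltngtP => [| |]; try lia.
  by move=> _; apply: (bounded_level _ m'U); lia.
exists m; split=> // [[a k] h|a k /andP[k0 ka]|a k k0|a].
- by rewrite mE /f; case: eqP => // /eqP k0; case: h; split=> //; rewrite lt0n.
- by rewrite mE /f ka gtn_eqF.
- rewrite mE /f gtn_eqF ?addn_gt0 ?k0 ?orbT // ltnNge leq_addr /=.
  by rewrite gtn_eqF ?addKn // -[X in (X < _)%N]addn0 ltn_add2l.
- rewrite mE /f gtn_eqF ?top_gt0 // ltnn eqxx -addnA subnK //; exact: xb.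
Qed.

(** At the cut [n] must have multiplicity [x a - tail m a 0]. The hypothesis, supplied by [tail_le]
    for admissible m, keeps this natural subtraction from truncating. *)
Lemma unglue_ex (x : node X -> nat) m : supported None m ->
  (forall a, (tail m a 0 <= x a)%N) -> exists m' n, glued l0 x m m' n.
Proof.
move=> ms xb; have mU := @bounded_depth X m; set U := depth m in mU.
pose f' (y : node X * nat) : nat := let: (a, k) := y in
  if k == 0%N then 0%N else m (a, (top l0 a + k)%N).
pose fn (y : node X * nat) : nat := let: (a, k) := y in
  if k == 0%N then 0%N else if (k < top l0 a)%N then m (a, (top l0 a - k)%N)
  else if k == top l0 a then (x a - tail m a 0)%N else 0%N.
have [|m' m'E] := @config_of f' U.+1.
  by move=> a k Uk; rewrite /f'; case: eqP => // _; apply: (bounded_level _ mU); lia.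
have [|n nE] := @config_of fn (6 * l0).+1.
  move=> a k lk; have := leq_pmull (top l0 a) (cell_gt0 a); rewrite cell_top => h.
  by rewrite /fn; case: eqP => // _; case: ltngtP => //; lia.
have ns : supported (Some l0) n.
  move=> [a k] h; rewrite nE /fn; case: eqP => // /eqP k0.
  case: ltngtP => // ak; case: h; split=> /=; rewrite -/(top l0 a) ?lt0n //; first exact:
    ltnW.
  by rewrite ak.
have m's : supported None m'.
  by move=> [a k] h; rewrite m'E /f'; case: eqP => // /eqP k0; case: h; split=> //;
    rewrite lt0n.
exists m', n; split=> // [a k /andP[k0 ka]|a k k0|a].
- by rewrite nE /fn subn_eq0 leqNgt ka /= ltn_subrL k0 (leq_ltn_trans _ ka) // subKn //
    ltnW.
- by rewrite m'E /f' gtn_eqF.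
have nB := bounded_some ns.
have m'U : bounded m' U.
  move=> c k Uk; rewrite m'E /f'; case: eqP => // _; apply: mU.
  by apply: leq_trans Uk _; rewrite leq_mul2l leq_addl orbT.
have t0 := top_gt0 l0_gt0 a.
have l6 : (top l0 a <= 6 * l0)%N by rewrite -(cell_top l0 a) leq_pmull ?cell_gt0.
rewrite (tail0E a nB (leqnn _)) (tail0E a m'U (leqnn _)).
have -> : (\sum_(1 <= k < (6 * l0).+1) n (a, k) =
    \sum_(1 <= k < top l0 a) m (a, k) + (x a - tail m a 0))%N.
  rewrite (@big_cat_nat _ _ _ (top l0 a).+1) //= [X in (_ + X)%N]big1_seq ?addn0 => [|k
    /andP[_]]; last first.
    rewrite mem_index_iota => /andP[ak _]; rewrite nE /fn.
    by case: eqP => // _; case: ltngtP ak.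
  rewrite big_nat_recr //= nE /fn gtn_eqF // ltnn eqxx; congr (_ + _)%N.
  rewrite [RHS]big_nat_rev /=; apply: eq_big_nat => k /andP[k0 ka].
  by rewrite nE /fn gtn_eqF // ka; congr (m (_, _)); lia.
have mt : (tail m a 0 = \sum_(1 <= k < top l0 a) m (a, k) + m (a, top l0 a) +
    \sum_(1 <= k < U.+1) m' (a, k))%N.
  rewrite (@tail0E m U (top l0 a + U.+1) a mU) ?leq_addl //.
  rewrite (@big_cat_nat _ _ _ (top l0 a)) //= ?leq_addr // -addnA; congr (_ + _)%N.
  rewrite -{1}[top l0 a]add0n big_addn addKn big_ltn //; congr (_ + _)%N.
  by apply: eq_big_nat => k /andP[k0 _]; rewrite m'E /f' gtn_eqF // addnC.
by have := xb a; rewrite mt; lia.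
Qed.

Lemma glued_inj (x : node X -> nat) m m1' m2' n1 n2 :
  glued l0 x m m1' n1 -> glued l0 x m m2' n2 -> m1' = m2' /\ n1 = n2.
Proof.
move=> g1 g2.
have e' : m1' = m2'.
  apply/fsfunP => -[a [|k]]; last by rewrite -(glued_high g1) // -(glued_high g2).
  by rewrite (supported0 a (glued_sup' g1)) (supported0 a (glued_sup' g2)).
split=> //.
have low a k : (0 < k < top l0 a)%N -> n1 (a, k) = n2 (a, k).
  case/andP=> k0 ka; have h : (0 < top l0 a - k < top l0 a)%N.
    by rewrite subn_gt0 ka ltn_subrL k0 (leq_ltn_trans _ ka).
  by have := glued_low g1 h; rewrite (glued_low g2 h) subKn 1?ltnW.
apply/fsfunP => -[a k].
have [->|k0] := posnP k.
  by rewrite (supported0 a (glued_supn g1)) (supported0 a (glued_supn g2)).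
have [ka|ka|->] := ltngtP k (top l0 a); first by rewrite low ?k0.
  have h : ~ Hset X (Some l0) (a, k) by case=> _ /=; rewrite leqNgt ka.
  by rewrite (glued_supn g1) // (glued_supn g2).
have := glued_top g1 a; rewrite -(glued_top g2 a) e'.
have nE n : supported (Some l0) n -> tail n a 0 =
    (\sum_(1 <= k < top l0 a) n (a, k) + n (a, top l0 a))%N.
  move=> ns; rewrite (tail0E a (bounded_some ns) (leqnn _)).
  have l6 : (top l0 a <= 6 * l0)%N by rewrite -(cell_top l0 a) leq_pmull ?cell_gt0.
  rewrite (@big_cat_nat _ _ _ (top l0 a).+1) //= [X in (_ + X)%N]big1_seq ?addn0 => [|j
    /andP[_]]; last first.
    rewrite mem_index_iota => /andP[aj _].
    by apply: (bounded_some ns); rewrite -(cell_top l0 a) ltn_pmul2l ?cell_gt0.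
  by rewrite big_nat_recr ?top_gt0.
rewrite (nE n1 (glued_supn g1)) (nE n2 (glued_supn g2)).
have -> : (\sum_(1 <= k < top l0 a) n1 (a, k) = \sum_(1 <= k < top l0 a) n2 (a, k))%N.
  by apply: eq_big_nat => j; exact: low.
by move=> /addIn /addnI /addnI.
Qed.

End GluingMaps.

Section TailBound.
Variables (X : affine_type) (b : node X) (l0 L : nat).
Hypothesis hX : valid_type X.
Hypothesis l0_gt0 : (0 < l0)%N.
Implicit Types (a c : node X) (m n : config X).

(* Nonnegativity of the vacancies at level 1 bounds the pairings of
   [xi - profile m 0] with the simple roots from below. *)
Lemma tail_le (x : node X -> nat) m lam :
  (forall a, ((t b * L)%:R *: wiota (fundwbar b)) 0 a = (t a * x a)%:R) ->
  admissible None (Wpower b (top l0 b) L) lam m ->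
  forall a, (tail m a 0 <= x a)%N.
Proof.
set xi := _ *: _ => xE [ms vac _].
have mU := @bounded_depth X m; set U := depth m in mU.
have pair_ge a : 0 <= invform (alpha a) (xi - profile m 0).
  have pair_le u : (u < cell a)%N ->
      invform (alpha a) (profile m 0) <= invform (alpha a) (profile m u).
    move=> ua; rewrite !invform_alphal; apply: ler_sum => c _; rewrite !profileE.
    have [<-|ac] := eqVneq a c.
      suff -> : tail m a 0 = tail m a u by [].
      rewrite !(tailE a _ mU (leqnn _)); apply: eq_bigr => -[|k] _; first by rewrite muln0.
      by rewrite muln_gt0 cell_gt0 (leq_trans ua) // leq_pmulr.
    rewrite ler_wnM2l ?gram_le0 // ler_nat leq_mul2l !(tailE c _ mU (leqnn _)).
    apply/orP; right; apply: leq_sum => k _; rewrite leq_mul2r; apply/orP; right.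
    by case: (ltnP u) => // /(leq_ltn_trans (leq0n u)) ->.
  have h1 : Hset X None (a, 1%N) by exact: Hset_one.
  have := vac _ h1; rewrite vacancyE // row_Wpower // muln1.
  have := @coef_xi X b L hX a 1; rewrite !muln1 => e.
  rewrite (minn_idPl _) ?top_gt0 // muln1 -e -mulrBr pmulr_rge0; last first.
    by rewrite divr_gt0 ?mulr_gt0 ?ltr0n ?t_gt0 ?tv_gt0.
  rewrite subr_ge0 => h; rewrite invformBr subr_ge0.
  rewrite -(ler_pM2l (_ : 0 < (cell a)%:R)) ?ltr0n ?cell_gt0 //; apply: le_trans h.
  rewrite mulr_natl -[X in _ *+ X]subn0 -sumr_const_nat big_nat_cond [leRHS]big_nat_cond.
  by apply: ler_sum => u /andP[/andP[_ ua] _]; exact: pair_le.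
move=> a; have := coord_ge0 hX pair_ge a.
rewrite mxE [X in _ + X]mxE profileE xE subr_ge0 ler_nat leq_pmul2l //.
exact: t_gt0.
Qed.

End TailBound.

(** * Products of q-binomials and the inversion of q *)

Section Products.
Variables (X : affine_type).
Implicit Types (a c : node X) (m n nu : config X) (zeta : {ffun node X -> nat}) (lev :
  level).

Definition qprod lev nu m : ratfun :=
  \big[*%R/1]_(y \in Hset X lev)
    qbinom (q ^+ tv y.1) (Num.truncn (vacancy lev nu m y)) (m y).

Lemma qbinom0 (F : fieldType) (x : F) p : qbinom x p 0 = 1.
Proof. by rewrite /qbinom big_geq. Qed.

Lemma qbinom_p0 (F : fieldType) (x : F) k :
  (forall i, (0 < i)%N -> 1 - x ^+ i != 0) -> qbinom x 0 k = 1.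
Proof.
by move=> x1; rewrite /qbinom big_nat_cond big1 // => i /andP[/andP[i0 _] _]; rewrite
  divff ?x1.
Qed.

Lemma qprod_rect lev nu m (K : node X -> nat) : supported lev m ->
  (forall a k, (K a <= k)%N -> m (a, k) = 0%N) ->
  qprod lev nu m = \prod_a \prod_(0 <= k < K a)
    qbinom (q ^+ tv a) (Num.truncn (vacancy lev nu m (a, k))) (m (a, k)).
Proof.
move=> ms mK; rewrite /qprod (@fsbig_rect_dep _ _ _ _ _ _ K) // => -[a k] h.
by have -> : m (a, k) = 0%N by [case: h => [/ms|/mK]]; exact: qbinom0.
Qed.

Lemma qadic_small_qprod lev nu m : supported lev m -> qadic_small 0 (qprod lev nu m).
Proof.
move=> ms; have mU := @bounded_depth X m.
rewrite (qprod_rect _ ms (K := fun=> (depth m).+1)) => [|a k]; last exact: bounded_level.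
by do 2?apply: qadic_small_prod => ? _; apply: qadic_small_qbinom; exact: tv_gt0.
Qed.

Lemma one_sub_qtv a i : (0 < i)%N -> 1 - (q ^+ tv a) ^+ i != 0.
Proof. by move=> i0; rewrite -exprM one_sub_qX_neq0 // muln_gt0 tv_gt0. Qed.

Section Glued.
Variables (b : node X) (l0 L : nat).
Hypothesis hX : valid_type X.
Hypothesis l0_gt0 : (0 < l0)%N.
Variable x : node X -> nat.
Hypothesis xE : forall a, ((t b * L)%:R *: wiota (fundwbar b)) 0 a = (t a * x a)%:R.
Variables m m' n : config X.
Hypothesis mg : glued l0 x m m' n.
Variable zeta : {ffun node X -> nat}.
Hypothesis zetaE : forall a, (zeta a)%:R = (t a)%:R / (6 * (tv a)%:R) *
  \sum_(0 <= u < 6 * l0) invform (alpha a) (profile n u).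

Lemma qprod_glued :
  qprod None (Wpower b (top l0 b) L) m =
  qprod None (Wzeta zeta) m' * qprod (Some l0) (Wzeta zeta) n *
  \prod_a qbinom (q ^+ tv a) (zeta a) (m (a, top l0 a)).
Proof.
have m'U := @bounded_depth X m'; set U := depth m' in m'U.
rewrite (qprod_rect _ (glued_sup mg) (K := fun a => (top l0 a + U.+1)%N)); last first.
  move=> a k ak; have ak' : (top l0 a + U < k)%N by rewrite -addnS.
  rewrite -(subnKC (leq_trans (leq_addr U _) (ltnW ak'))) (glued_high mg); last by lia.
  by apply: (bounded_level _ m'U); lia.
rewrite (qprod_rect _ (glued_sup' mg) (K := fun=> U.+1)); last first.
  by move=> a k; exact: bounded_level.
rewrite (qprod_rect _ (glued_supn mg) (K := fun a => (top l0 a).+1)); last first.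
  move=> a k ak; apply: (bounded_some (glued_supn mg)).
  by rewrite -(cell_top l0 a) ltn_pmul2l ?cell_gt0.
rewrite -!big_split; apply: eq_bigr => a _ /=.
have t0 := top_gt0 l0_gt0 a.
rewrite (@big_cat_nat _ _ _ (top l0 a)) //= ?leq_addr //.
rewrite -{2}[top l0 a]add0n big_addn addKn [X in X * _ = _]big_ltn // [X in _ * X =
  _]big_ltn //.
rewrite (supported0 a (glued_sup mg)) qbinom0 mul1r add0n (vacancy_glued_top hX l0_gt0 xE
  mg zetaE) natrK.
rewrite mulrCA [RHS]mulrC; congr (_ * _); rewrite mulrC.
rewrite [X in _ = X * _]big_ltn // (supported0 a (glued_sup' mg)) qbinom0 mul1r.
rewrite [X in _ = _ * X]big_nat_recr //= [X in _ = _ * (X * _)]big_ltn // (supported0 a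
  (glued_supn mg)) qbinom0 mul1r.
(* The cut level of n has vacancy 0 and contributes 1; the cut level of m has been moved to the last
   product. *)
rewrite (vacancy_restricted_top l0_gt0 mg zetaE) truncn0 (qbinom_p0 _ (@one_sub_qtv a))
  mulr1.
congr (_ * _).
  apply: eq_big_nat => k /andP[k0 _]; rewrite addnC (glued_high mg) //.
  by rewrite (vacancy_high hX l0_gt0 xE mg zetaE).
rewrite big_nat_rev /=; apply: eq_big_nat => k /andP[k0 ka].
have -> : (1 + top l0 a - k.+1 = top l0 a - k)%N by lia.
have h : (0 < top l0 a - k < top l0 a)%N by lia.
by rewrite (glued_low mg h) (vacancy_reflect hX l0_gt0 xE mg zetaE h) subKn // ltnW.
Qed.

End Glued.

End Products.

Section Duality.
Variables (X : affine_type).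
Implicit Types (a c : node X) (m n nu : config X) (lev : level).

Lemma energy_ge0 m : valid_type X -> 0 <= energy m.
Proof.
move=> hX; apply: mulr_ge0; first by [].
by apply: sumr_ge0 => u _; exact: invform_ge0.
Qed.

Lemma energy_int lev m : supported lev m -> energy m \is a Num.int.
Proof.
move=> ms; have mU := @bounded_depth X m.
(* Taking [m] itself as [nu] expresses the energy through an integral cocharge and integral
   vacancies. *)
have := cocharge_dual ms ms mU (leqnn _); rewrite -(energyE mU) => e.
rewrite -[energy m]opprK -e rpredN rpredD ?cocharge_int // rpred_sum // => a _.
by rewrite rpred_sum // => k _; rewrite !rpredM ?rpred_nat // vacancy_int.
Qed.

Lemma fermionic_term_inv lev nu m : supported lev nu -> supported lev m ->
  (forall y, Hset X lev y -> 0 <= vacancy lev nu m y) ->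
  q^-1 ^ Num.floor (cocharge lev nu m) *
    \big[*%R/1]_(y \in Hset X lev)
      qbinom (q^-1 ^+ tv y.1) (Num.truncn (vacancy lev nu m y)) (m y) =
  q ^ Num.floor (energy m) * qprod lev nu m.
Proof.
move=> nus ms vac; have mU := @bounded_depth X m; set U := depth m in mU.
pose p a k := Num.truncn (vacancy lev nu m (a, k)).
(* At pairs outside H the truncation may alter the vacancy, but m vanishes there. *)
have pE a k : (p a k)%:R * (m (a, k))%:R = vacancy lev nu m (a, k) * (m (a, k))%:R.
  have [h|h] := pselect (Hset X lev (a, k)); last by rewrite (ms _ h) !mulr0.
  rewrite /p truncnK // natrEint vacancy_int /= vac //.
rewrite (@fsbig_rect _ _ _ _ _ _ U.+1); last first.
  move=> [a k] h; suff -> : m (a, k) = 0%N by exact: qbinom0.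
  by case: h => [/ms|/(bounded_level _ mU)].
rewrite (qprod_rect _ ms (K := fun=> U.+1)) => [|a k]; last exact: bounded_level.
pose e := (\sum_a \sum_(0 <= k < U.+1) tv a * (p a k * m (a, k)))%N.
have -> : \prod_a \prod_(0 <= k < U.+1)
    qbinom (q^-1 ^+ tv a) (Num.truncn (vacancy lev nu m (a, k))) (m (a, k)) =
  (q ^+ e)^-1 * \prod_a \prod_(0 <= k < U.+1)
    qbinom (q ^+ tv a) (Num.truncn (vacancy lev nu m (a, k))) (m (a, k)).
  rewrite /e -prodrXr -prodfV -big_split; apply: eq_bigr => a _ /=.
  rewrite -prodrXr -prodfV -big_split; apply: eq_bigr => k _ /=.
  by rewrite exprVn qbinomV ?expf_neq0 ?q_neq0 // -exprM.
rewrite mulrA; congr (_ * _).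
have eE : energy m = (- (Num.floor (cocharge lev nu m) + e%:Z))%:~R.
  rewrite rmorphN rmorphD /= floorK ?cocharge_int // -pmulrn.
  have := cocharge_dual ms nus mU (leqnn _); rewrite -(energyE mU).
  move/(congr1 -%R); rewrite opprK => <-; congr (- (_ + _)).
  rewrite /e natr_sum; apply: eq_bigr => a _; rewrite natr_sum; apply: eq_bigr => k _.
  by rewrite -mulrA -pE !natrM.
by rewrite eE intrKfloor opprD expfzDr ?q_neq0 // exprz_inv -exprnN.
Qed.

Lemma fermionicV lev nu lam : supported lev nu ->
  fermionic lev nu lam q^-1 =
  \sum_(m <- fset_set (admissible lev nu lam))
    q ^ Num.floor (energy m) * qprod lev nu m.
Proof.
move=> nus; rewrite /fermionic fsbig_finite; last exact: admissible_finite.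
rewrite big_seq [RHS]big_seq; apply: eq_bigr => m.
rewrite in_fset_set; last exact: admissible_finite.
by move=> /set_mem [ms vac _]; exact: fermionic_term_inv.
Qed.

End Duality.

(** * Triples (zeta, m', n) ordered by exponent *)

Section Triples.
Variables (X : affine_type) (l0 : nat) (lam : weight X).
Hypothesis hX : valid_type X.
Hypothesis l0_gt0 : (0 < l0)%N.
Implicit Types (a c : node X) (m n : config X) (zeta : {ffun node X -> nat}).

Definition triple : choiceType := ({ffun node X -> nat} * config X * config X)%type.
Implicit Types tau : triple.

Definition triples : set triple :=
  [set tau : triple | admissible None (Wzeta tau.1.1) lam tau.1.2 /\
    admissible (Some l0) (Wzeta tau.1.1) 0 tau.2].

Definition expo tau : int := Num.floor (energy tau.1.2) + Num.floor (energy tau.2).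

(** The factor common to both sides; [finterm] completes it for finite L, [term] in the limit. *)
Definition body tau : ratfun :=
  q ^ expo tau *
    (qprod None (Wzeta tau.1.1) tau.1.2 * qprod (Some l0) (Wzeta tau.1.1) tau.2).

Definition term tau : ratfun := body tau / \prod_a qpoch (q ^+ tv a) (tau.1.1 a).

(** The multiplicity at the cut of the glued configuration, provided the triple fits under [x];
    otherwise the subtraction truncates. *)
Definition slack (x : node X -> nat) tau a : nat :=
  x a - (tail tau.2 a 0 + tail tau.1.2 a 0).

Definition finterm (x : node X -> nat) tau : ratfun :=
  body tau * \prod_a qbinom (q ^+ tv a) (tau.1.1 a) (slack x tau a).

Lemma expo_ge0 tau : 0 <= expo tau.
Proof. by apply: addr_ge0; rewrite floor_ge0; exact: energy_ge0. Qed.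

Lemma qadic_small_body tau : triples tau -> qadic_small (expo tau) (body tau).
Proof.
move=> [[s1 _ _] [s2 _ _]]; rewrite /body mulrC; apply: qadic_smallMr; last exact:
  qadic_small_qX.
by apply: qadic_smallMr; exact: qadic_small_qprod.
Qed.

Lemma qadic_small_term tau : triples tau -> qadic_small (expo tau) (term tau).
Proof.
move=> /qadic_small_body h; rewrite /term mulrC; apply: qadic_smallMr h.
rewrite -prodfV; apply: qadic_small_prod => a _; apply: qadic_small_qpochV; exact: tv_gt0.
Qed.

Lemma qadic_small_finterm x tau : triples tau -> qadic_small (expo tau) (finterm x tau).
Proof.
move=> /qadic_small_body h; rewrite /finterm mulrC; apply: qadic_smallMr h.
by apply: qadic_small_prod => a _; apply: qadic_small_qbinom; exact: tv_gt0.
Qed.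

Lemma qadic_cong_term (N : nat) x tau : triples tau ->
  N%:Z <= expo tau \/ (forall a, (N <= slack x tau a)%N) ->
  qadic_small N (finterm x tau - term tau).
Proof.
move=> tt [hN|hN].
  apply: (qadic_small_le hN); apply: qadic_smallB.
    exact: qadic_small_finterm.
  exact: qadic_small_term.
rewrite /finterm /term -prodfV -mulrBr; apply: qadic_smallMr.
  exact: qadic_small_le (expo_ge0 tau) (qadic_small_body tt).
apply: qadic_cong_prod => a _.
- exact/qadic_small_qbinom/tv_gt0.
- exact/qadic_small_qpochV/tv_gt0.
- by apply: qadic_qbinom_lim; first exact: tv_gt0.
Qed.

Lemma restricted_zetaE zeta n : admissible (Some l0) (Wzeta zeta) 0 n ->
  forall a, (zeta a)%:R = (t a)%:R / (6 * (tv a)%:R) *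
    \sum_(0 <= u < 6 * l0) invform (alpha a) (profile n u).
Proof.
move=> [ns _]; rewrite wiota_Wzeta // raddf0 subr0 (weight_form ns (bounded_some ns)) =>
  e a.
have := congr1 (invform (alpha a)) e; rewrite invformZr !invform_sumr [RHS](bigD1 a) //=.
rewrite [X in _ = _ + X]big1 => [|c /negPf ca].
  rewrite addr0 invformZr invform_alpha_iota // eqxx mul1r => h.
  apply: (mulIf (_ : (tv a)%:R / (t a)%:R != 0)); first by rewrite mulf_neq0 ?invr_neq0
    ?t_neq0 ?tv_neq0.
  by rewrite -h; field; rewrite t_neq0 tv_neq0.
by rewrite invformZr invform_alpha_iota // eq_sym ca mul0r mulr0.
Qed.

(* The pairings [(alpha a|profile n u)] are bounded by completing the square. *)
Lemma zeta_bound zeta n : admissible (Some l0) (Wzeta zeta) 0 n -> forall a,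
  (zeta a)%:R <= (t a)%:R / (12 * (tv a)%:R) *
    ((6 * l0)%:R * invform (alpha a) (alpha a) + 12 * energy n).
Proof.
move=> nadm a; rewrite (restricted_zetaE nadm); case: nadm => ns _ _.
rewrite (energyE (bounded_some ns)).
have h : 2 * (\sum_(0 <= u < 6 * l0) invform (alpha a) (profile n u)) <=
    (6 * l0)%:R * invform (alpha a) (alpha a) +
    \sum_(0 <= u < 6 * l0) invform (profile n u) (profile n u).
  have -> : (6 * l0)%:R * invform (alpha a) (alpha a) =
      \sum_(0 <= u < 6 * l0) invform (alpha a) (alpha a).
    by rewrite sumr_const_nat subn0 mulr_natl.
  rewrite -big_split mulr_sumr /=.
  apply: ler_sum => u _; have := invform_ge0 hX (alpha a - profile n u).
  by rewrite invformBr !invformBl (invformC (profile n u)); lra.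
have c0 : 0 <= (t a)%:R / (12 * (tv a)%:R) :> rat by rewrite divr_ge0 // mulr_ge0.
have := ler_wpM2l c0 h; congr (_ <= _); last by rewrite mulrA mulfV ?mul1r.
by field; rewrite tv_neq0.
Qed.

(** The energy of n bounds zeta by [zeta_bound], and for each zeta there are finitely many
    admissible m' and n. *)
Lemma finite_low (N : nat) : finite_set [set tau | triples tau /\ expo tau < N%:Z].
Proof.
pose B a := (t a)%:R / (12 * (tv a)%:R) *
    ((6 * l0)%:R * invform (alpha a) (alpha a) + 12 * N%:R) : rat.
pose C := (\sum_a Num.truncn (B a))%N.
pose Z : set {ffun node X -> nat} :=
  (fun g : {ffun node X -> 'I_C.+1} => [ffun a => val (g a)]) @` setT.
have Zfin : finite_set Z by apply/finite_image/finite_finset.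
pose F zeta : set triple := (fun p : config X * config X => (zeta, p.1, p.2)) @`
  (admissible None (Wzeta zeta) lam `*` admissible (Some l0) (Wzeta zeta) 0).
apply: (@sub_finite_set _ _ (\bigcup_(zeta in Z) F zeta)); last first.
  apply: bigcup_finite => // zeta _; apply/finite_image/finite_setX; exact:
    admissible_finite.
move=> [[zeta m'] n] /= [[/= m'adm nadm] ltN]; exists zeta; last by exists (m', n).
have en : energy n <= N%:R.
  apply: le_trans (_ : (Num.floor (energy n))%:~R <= _).
    by rewrite floorK; last by case: nadm => ns _ _; exact: energy_int ns.
  rewrite -[N%:R]/((N%:Z)%:~R) ler_int; apply: le_trans (ltW ltN).
  by rewrite /expo /= lerDr floor_ge0 energy_ge0.
have zC a : (zeta a <= C)%N.
  apply: (@leq_trans (Num.truncn (B a))); last by rewrite /C (bigD1 a) //= leq_addr.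
  have zB : (zeta a)%:R <= B a.
    apply: le_trans (zeta_bound nadm a) _; rewrite /B.
    apply: ler_wpM2l; first by rewrite divr_ge0 // mulr_ge0.
    by rewrite lerD2l ler_pM2l.
  by rewrite truncn_ge_nat // (le_trans _ zB).
exists [ffun a => inord (zeta a)] => //.
by apply/ffunP => a; rewrite !ffunE /= inordK ?ltnS.
Qed.

Definition low (N : nat) : {fset triple} := fset_set [set tau | triples tau /\ expo tau <
  N%:Z].

Lemma lowP N tau : tau \in low N <-> triples tau /\ expo tau < N%:Z.
Proof. by rewrite /low in_fset_set; [rewrite inE | exact: finite_low]. Qed.

Lemma sum_low_near (N : nat) (s : seq triple) : uniq s ->
  (forall tau, tau \in s -> triples tau) -> {subset low N <= s} ->
  qadic_small N (\sum_(tau <- s) term tau - \sum_(tau <- low N) term tau).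
Proof.
move=> us sT lows; rewrite (bigID (mem (low N))) /= addrAC -[X in qadic_small _ X]addrC.
have -> : \sum_(tau <- s | tau \in low N) term tau = \sum_(tau <- low N) term tau.
  rewrite -big_filter; apply: perm_big; apply: uniq_perm; rewrite ?filter_uniq ?fset_uniq
    //.
  by move=> tau; rewrite mem_filter; case: (boolP (tau \in low N)) => //= /lows.
rewrite subrr addr0 big_seq_cond; apply: qadic_small_sum => tau /andP[ts /negP tN].
have tt := sT _ ts; apply: qadic_small_le (qadic_small_term tt).
by rewrite leNgt; apply/negP => h; apply: tN; apply/lowP.
Qed.

(** One series for both sides: each need only be shown congruent modulo q^N to the sum over
    [low N]. *)
Lemma sum_low_limit : exists2 S : laurent, pole S = 0%N &
  forall (N : nat) y, qadic_small N (y - \sum_(tau <- low N) term tau) -> qadic_near S N y.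
Proof.
have [|N|S S0 SN] := @qadic_complete (fun N => \sum_(tau <- low N) term tau).
- rewrite big_seq; apply: qadic_small_sum => tau /lowP[tt _].
  exact: qadic_small_le (expo_ge0 tau) (qadic_small_term tt).
- apply: sum_low_near; first exact: fset_uniq.
    by move=> tau /lowP[].
  move=> tau /lowP[tt h]; apply/lowP; split; first exact: tt.
  by apply: (lt_trans h); rewrite ltz_nat.
exists S => // N y h; rewrite /qadic_near -(subrKA (\sum_(tau <- low N) term tau)).
by apply: qadic_smallD; [rewrite S0 subr0 | exact: SN].
Qed.

End Triples.

Lemma glued_uniq (X : affine_type) (l0 : nat) (x : node X -> nat) (m1 m2 m' n : config X) :
  glued l0 x m1 m' n -> glued l0 x m2 m' n -> m1 = m2.
Proof.
move=> g1 g2; apply/fsfunP => -[a k].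
have [->|k0] := posnP k.
  by rewrite (supported0 a (glued_sup g1)) (supported0 a (glued_sup g2)).
have [ka|ka|->] := ltngtP k (top l0 a).
- by rewrite (glued_low g1) ?k0 // (glued_low g2) ?k0.
- by rewrite -(subnKC (ltnW ka)) (glued_high g1) ?subn_gt0 // (glued_high g2) ?subn_gt0.
- by have := glued_top g1 a; rewrite -(glued_top g2 a) => /addIn /addIn.
Qed.

(** * The left side for fixed L *)

Section PowerSide.
Variables (X : affine_type) (b : node X) (l0 L : nat) (lam : weight X).
Hypothesis hX : valid_type X.
Hypothesis l0_gt0 : (0 < l0)%N.
Variable x : node X -> nat.
Hypothesis xE : forall a, ((t b * L)%:R *: wiota (fundwbar b)) 0 a = (t a * x a)%:R.

Let c0 : rat := - (L%:R ^+ 2 * (top l0 b)%:R * (t b)%:R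
       * invform (wiota (fundwbar b)) (wiota (fundwbar b)) / 2).

(* [c0] is the cocharge of the configuration glued from empty ones. *)
Lemma c0_int : c0 \is a Num.int.
Proof.
have [|z zE] := @config_of X (fun=> 0%N) 0; first by [].
have zs lev : supported lev z by move=> y _; exact: zE.
have zt a : tail z a 0 = 0%N.
  by rewrite (tailE a 0 (@bounded_depth X z) (leqnn _)) big1 // => k _; rewrite zE muln0.
have [|m mg] := @glued_ex X l0 l0_gt0 x z z (zs _) (zs _); first by move=> a; rewrite !zt.
have -> : c0 = cocharge None (Wpower b (top l0 b) L) m - energy z - energy z.
  by rewrite (cocharge_glued hX l0_gt0 xE mg) -/c0 !addrK.
apply: rpredB (energy_int (zs None)); apply: rpredB (energy_int (zs None)).
exact: cocharge_int.
Qed.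

Definition fitting : set (triple X) :=
  [set tau | triples l0 lam tau /\
    forall a, (tail tau.2 a 0 + tail tau.1.2 a 0 <= x a)%N].

Lemma glue_bij : exists h : triple X -> config X,
  (forall tau, fitting tau -> glued l0 x (h tau) tau.1.2 tau.2) /\
  set_bij fitting (admissible None (Wpower b (top l0 b) L) lam) h.
Proof.
have /choice[h hP] : forall tau : triple X, exists m, fitting tau -> glued l0 x m tau.1.2
  tau.2.
  move=> tau; have [[[[s1 _ _] [s2 _ _]] tx]|ft] := pselect (fitting tau).
    by have [m mg] := glued_ex l0_gt0 s1 s2 tx; exists m.
  (* An arbitrary value for triples that do not fit. *)
  by exists tau.2.
exists h; split=> //; split.
- move=> tau ft; have [[tt1 tt2] _] := ft.
  exact: ((glued_admissible hX l0_gt0 xE (hP _ ft) (restricted_zetaE hX l0_gt0 tt2)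
    lam).2 (conj tt1 tt2)).
- move=> [[z1 m1] n1] [[z2 m2] n2] /set_mem f1 /set_mem f2 e.
  have := hP _ f1; rewrite e => g1; have [/= e1 e2] := glued_inj l0_gt0 g1 (hP _ f2).
  have [[_ /= a1] _] := f1; have [[_ /= a2] _] := f2.
  congr (_, _, _) => //; apply/ffunP => a; apply/eqP; rewrite -(eqr_nat rat).
  by rewrite (restricted_zetaE hX l0_gt0 a1) (restricted_zetaE hX l0_gt0 a2) e2.
- move=> m madm; have [ms vac _] := madm.
  have [m' [n mg]] := unglue_ex l0_gt0 ms (tail_le hX l0_gt0 xE madm).
  (* Admissibility of m makes these vacancies nonnegative, so [Num.truncn] loses nothing and they
     satisfy [zetaE]. *)
  pose zeta := [ffun a => Num.truncn (vacancy None (Wpower b (top l0 b) L) m (a, top l0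
    a))].
  have zetaE a : (zeta a)%:R = (t a)%:R / (6 * (tv a)%:R) *
      \sum_(0 <= u < 6 * l0) invform (alpha a) (profile n u).
    rewrite ffunE truncnK ?natrEint ?vacancy_int ?vac //; last by split=> //; exact:
      top_gt0.
    rewrite (vacancy_low hX l0_gt0 xE mg) ?top_gt0 ?leqnn // cell_top.
    rewrite -(sum_rev (fun u => invform (alpha a) (profile n u)) (leqnn _)).
    by rewrite subnn [X in _ + X]big_geq ?addr0.
  have [adm1 adm2] := (glued_admissible hX l0_gt0 xE mg zetaE lam).1 madm.
  have ft : fitting (zeta, m', n).
    by split=> // a; rewrite -(glued_top mg a) -addnA leq_addl.
  exists (zeta, m', n) => //.
  exact: glued_uniq (hP _ ft) mg.
Qed.

Lemma finite_fitting : finite_set fitting.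
Proof.
have [h [_ [hfun hinj _]]] := glue_bij; rewrite -(eq_finite_set (inj_card_eq hinj)).
apply: sub_finite_set (@admissible_finite X None (Wpower b (top l0 b) L) lam).
by move=> _ [tau ft <-]; exact: hfun.
Qed.

Lemma fermionic_power : q ^ (- Num.floor c0) * fermionic None (Wpower b (top l0 b) L) lam
  q =
  \sum_(tau <- fset_set fitting) finterm l0 x tau.
Proof.
have [h [hg hb]] := glue_bij.
rewrite /fermionic (@reindex_fsbig _ _ _ _ _ h _ _ _ hb) fsbig_finite; last exact:
  finite_fitting.
rewrite mulr_sumr big_seq [RHS]big_seq; apply: eq_bigr => tau.
rewrite in_fset_set; last exact: finite_fitting.
move=> /set_mem ft; have [[tt1 tt2] _] := ft; have mg := hg _ ft.
rewrite -/(qprod None (Wpower b (top l0 b) L) (h tau)).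
rewrite (qprod_glued hX l0_gt0 xE mg (restricted_zetaE hX l0_gt0 tt2)) /finterm /body.
rewrite (cocharge_glued hX l0_gt0 xE mg) -/c0 !mulrA; congr (_ * _ * _ * _); last first.
  apply: eq_bigr => a _; congr qbinom.
  by rewrite /slack -(glued_top mg a) -addnA addnK.
have [s1 _ _] := tt1; have [s2 _ _] := tt2.
rewrite /expo -expfzDr ?q_neq0 //; congr (q ^ _).
have /intrP[z0 ->] := c0_int; have /intrP[z1 ->] := energy_int s1.
by have /intrP[z2 ->] := energy_int s2; rewrite -!rmorphD /= !intrKfloor -addrA addKr.
Qed.

End PowerSide.

(** * The right side over finite sets of zeta *)

Section Restricted.
Variables (X : affine_type) (l0 : nat) (lam : weight X).
Hypothesis hX : valid_type X.
Hypothesis l0_gt0 : (0 < l0)%N.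

Lemma fermionic_restricted (zeta : {ffun node X -> nat}) :
  fermionic None (Wzeta zeta) lam q^-1 * fermionic (Some l0) (Wzeta zeta) 0 q^-1 /
    \prod_a qpoch (q ^+ tv a) (zeta a) =
  \sum_(m <- fset_set (admissible None (Wzeta zeta) lam))
    \sum_(n <- fset_set (admissible (Some l0) (Wzeta zeta) 0))
      term l0 ((zeta, m, n) : triple X).
Proof.
rewrite !fermionicV; [|exact: supported_Wzeta|exact: supported_Wzeta].
rewrite -mulrA mulr_suml; apply: eq_bigr => m _; rewrite mulr_suml mulr_sumr.
apply: eq_bigr => n _; rewrite /term /body /expo /= expfzDr ?q_neq0 //.
by rewrite [in RHS]mulrACA !mulrA.
Qed.

Lemma triples_seq (J : {fset {ffun node X -> nat}}) : exists s : seq (triple X),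
  [/\ uniq s, forall tau, tau \in s <-> triples l0 lam tau /\ tau.1.1 \in J &
    \sum_(tau <- s) term l0 tau =
    \sum_(zeta <- J) \sum_(m <- fset_set (admissible None (Wzeta zeta) lam))
      \sum_(n <- fset_set (admissible (Some l0) (Wzeta zeta) 0)) term l0 (zeta, m, n)].
Proof.
pose A1 (zeta : {ffun node X -> nat}) := fset_set (admissible None (Wzeta zeta) lam).
pose A2 (zeta : {ffun node X -> nat}) := fset_set (admissible (Some l0) (Wzeta zeta) 0).
exists [seq (p, n) | p <- [seq (zeta, m) | zeta <- J, m <- A1 zeta], n <- A2 p.1]; split.
- apply: allpairs_uniq_dep => [|p _|[p n] [p' n'] _ _ /= [-> ->]] //.
  by apply: allpairs_uniq_dep => [|z _|[z m] [z' m'] _ _ /= [-> ->]]; rewrite ?fset_uniq.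
- move=> [[z m] n]; split=> [/allpairsPdep[p [n' [pin n'in [-> ->]]]]|[[/= h1 h2] zJ]].
    move: pin n'in => /allpairsPdep[z' [m' [z'J m'in ->]]] /=.
    move: m'in; rewrite /A1 /A2 !in_fset_set; [|exact: admissible_finite|exact:
      admissible_finite].
    by move=> /set_mem h1 /set_mem h2; split.
  apply/allpairsPdep; exists (z, m), n; split=> //; last first.
    by rewrite /A2 in_fset_set ?mem_set //; exact: admissible_finite.
  apply/allpairsPdep; exists z, m; split=> //.
  by rewrite /A1 in_fset_set ?mem_set //; exact: admissible_finite.
- by rewrite !big_allpairs_dep.
Qed.

(** The weight condition on n, with total multiplicities [k], puts every zeta that occurs into the
    index set of the sum. *)
Lemma triple_zeta (tau : triple X) : triples l0 lam tau ->
  exists k : node X -> nat,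
    \sum_a (tau.1.1 a)%:R *: wiota (fundwbar a) = \sum_a (k a)%:R *: alpha a.
Proof.
case: tau => [[zeta m'] n] [_ [/= ns _]]; rewrite wiota_Wzeta // raddf0 subr0 => <-.
have nB := bounded_some ns.
exists (fun a => \sum_(0 <= k < (6 * l0).+1) k * n (a, k))%N.
rewrite (@fsbig_rect _ _ _ _ _ _ (6 * l0).+1); last first.
  case=> a k h; suff -> : n (a, k) = 0%N by rewrite muln0 scale0r.
  by case: h => [/ns|/(bounded_level _ nB)].
by apply: eq_bigr => a _; rewrite natr_sum scaler_suml.
Qed.

End Restricted.

(* [x a] is the multiplicity at level [top a] of the configuration of least
   cocharge. *)
Lemma ground_state_ex (X : affine_type) (b : node X) (L : nat) : valid_type X ->
  (forall a : node X, L%:R * invform (wiota (fundwbar a)) (wiota (fundwbar b))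
          / (tv a * t b)%:R \is a Num.int) ->
  exists x : node X -> nat,
    forall a, ((t b * L)%:R *: wiota (fundwbar b)) 0 a = (t a * x a)%:R :> rat.
Proof.
move=> hX good.
pose z a := L%:R * invform (wiota (fundwbar a)) (wiota (fundwbar b)) / (tv a * t b)%:R :
  rat.
have zE a : ((t b * L)%:R *: wiota (fundwbar b)) 0 a = (t a)%:R * ((t b)%:R ^+ 2 * z a).
  rewrite mxE (coord_iota hX) invformC /z !natrM.
  by field; rewrite tv_neq0 t_neq0.
have z0 a : 0 <= z a.
  have : 0 <= ((t b * L)%:R *: wiota (fundwbar b)) 0 a.
    by rewrite mxE mulr_ge0 // ltW // iota_coord_gt0.
  by rewrite zE pmulr_rge0 ?ltr0n ?t_gt0 // pmulr_rge0 // exprn_gt0 // ltr0n t_gt0.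
(* Coordinate a of xi is t_a t_b^2 [z a], where [z a] is the number whose integrality is imposed on
   L. *)
exists (fun a => t b ^ 2 * Num.truncn (z a))%N => a.
by rewrite zE expr2 -mulnn !natrM truncnK // natrEint z0 andbT; exact: good.
Qed.

Lemma ground_state_large (X : affine_type) (b : node X) (B : nat) : valid_type X ->
  exists L0, forall (L : nat) (x : node X -> nat), (L0 <= L)%N ->
    (forall a, ((t b * L)%:R *: wiota (fundwbar b)) 0 a = (t a * x a)%:R :> rat) ->
    forall a, (B <= x a)%N.
Proof.
move=> hX; pose r a : rat := (t a * B)%:R / wiota (fundwbar b) 0 a.
exists (\sum_a (Num.truncn (r a)).+1)%N => L x LL xE a.
have i0 := iota_coord_gt0 hX b a.
have rL : r a <= L%:R.
  apply: (@le_trans _ _ (Num.truncn (r a)).+1%:R).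
    by apply/ltW/truncnS_gt; rewrite divr_ge0 ?ltW.
  rewrite ler_nat; apply: leq_trans LL; rewrite (bigD1 a) //=; exact: leq_addr.
rewrite -(leq_pmul2l (t_gt0 a)) -(ler_nat rat) -xE mxE.
move: rL; rewrite /r ler_pdivrMr // => /le_trans; apply.
by rewrite ler_pM2r // ler_nat leq_pmull ?t_gt0.
Qed.

Theorem proposition4p3 (X : affine_type) (hX : valid_type X) (b : node X)
    (l : nat) (hl : (1 <= l)%N) (htl : (t b %| l)%N) (lam : weight X) :
  let goodL : set nat :=
    [set L | (1 <= L)%N /\
      forall a : node X,
        L%:R * invform (wiota (fundwbar a)) (wiota (fundwbar b))
          / (tv a * t b)%:R \is a Num.int] in
  let c0 (L : nat) : rat :=
    - (L%:R ^+ 2 * l%:R * (t b)%:R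
       * invform (wiota (fundwbar b)) (wiota (fundwbar b)) / 2) in
  let zetas : set {ffun node X -> nat} :=
    [set zeta : {ffun node X -> nat} | exists k : node X -> nat,
      \sum_a (zeta a)%:R *: wiota (fundwbar a) = \sum_a (k a)%:R *: alpha a] in
  (forall L, goodL L -> c0 L \is a Num.int) /\
  exists S : laurent,
    qadic_limit goodL
      (fun L => q ^ (- Num.floor (c0 L)) *
                fermionic None (Wpower b l L) lam q) S /\
    qadic_sum zetas
      (fun zeta =>
         fermionic None (Wzeta zeta) lam q^-1 *
         fermionic (Some (l %/ t b)%N) (Wzeta zeta) 0 q^-1 /
         \prod_a qpoch (q ^+ tv a) (zeta a)) S.
Proof.
have [l0 lE] : exists l0, l = top l0 b by case/dvdnP: htl => k ->; exists k; rewrite mulnC.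
have l0_gt0 : (0 < l0)%N by move: hl; rewrite lE muln_gt0 => /andP[].
have -> : (l %/ t b = l0)%N by rewrite lE mulKn ?t_gt0.
rewrite {l hl htl}lE => goodL c0 zetas; split=> [L [_ good]|].
  have [x xE] := ground_state_ex hX good.
  exact: (c0_int hX l0_gt0 xE).
have [S S0 SN] := sum_low_limit lam hX l0_gt0.
exists S; split=> [N|N].
  (* With [x a] at least [B], every triple of [low N] fits and has slack at least N in every row. *)
  pose B := (N + \max_(tau <- low l0 lam N) \sum_a (tail tau.2 a 0 + tail tau.1.2 a 0))%N.
  have [L0 hL0] := ground_state_large b B hX.
  exists L0 => L LL [_ good]; have [x xE] := ground_state_ex hX good.
  apply: SN; rewrite (fermionic_power lam hX l0_gt0 xE).
  have slack_ge tau : tau \in low l0 lam N -> forall a,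
      (N + (tail tau.2 a 0 + tail tau.1.2 a 0) <= x a)%N.
    move=> tauN a; apply: leq_trans (hL0 _ _ LL xE a); rewrite leq_add2l.
    apply: (@leq_trans (\sum_c (tail tau.2 c 0 + tail tau.1.2 c 0))%N).
      by rewrite (bigD1 a) //= leq_addr.
    exact: (@leq_bigmax_seq _ _ _ (fun tau : triple X =>
      \sum_c (tail tau.2 c 0 + tail tau.1.2 c 0))%N tau tauN isT).
  set s := fset_set _.
  have sP tau : tau \in s <-> fitting l0 lam x tau.
    by rewrite /s in_fset_set ?inE //; exact: (finite_fitting lam hX l0_gt0 xE).
  (* First [finterm] is replaced by [term] on all fitting triples: those outside [low N] are
     negligible by exponent, the others by slack. Then the sum is cut down to [low N]. *)
  rewrite -(subrKA (\sum_(tau <- s) term l0 tau)); apply: qadic_smallD; last first.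
    apply: (sum_low_near hX l0_gt0) => [|tau /sP[] //|tau tauN]; first exact: fset_uniq.
    apply/sP; split; first by case/(lowP _ hX l0_gt0): tauN.
    by move=> a; apply: leq_trans (slack_ge _ tauN a); exact: leq_addl.
  rewrite -sumrB big_seq; apply: qadic_small_sum => tau /sP[tt fit].
  apply: (qadic_cong_term hX tt); have [|lt] := leP N%:Z (expo tau); first by left.
  right=> a; have tauN : tau \in low l0 lam N by apply/(lowP _ hX l0_gt0).
  have := slack_ge _ tauN a; rewrite /slack; have := fit a; lia.
(* Any J containing the zeta of all triples in [low N] yields a sum that includes all those
   triples. *)
exists [fset tau.1.1 | tau in low l0 lam N]%fset.
  move=> _ /= /imfsetP[tau /= /(lowP _ hX l0_gt0)[tt _] ->].
  exact: triple_zeta tt.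
move=> J J0J Jz; apply: SN; under eq_bigr do rewrite fermionic_restricted //.
have [s [us sP <-]] := triples_seq l0 lam J.
apply: (sum_low_near hX l0_gt0) => // [tau /sP[] //|tau tauN].
apply/sP; split; first by case/(lowP _ hX l0_gt0): tauN.
by apply: (fsubsetP J0J); apply/imfsetP; exists tau.
Qed.
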